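(* Let $\mathcal{S}$ be an algebra (with finitely many operations) that admits an injective unary FA-presentation $(a^*,\phi)$, and let $\mathcal{T}$ be a finitely generated subalgebra of $\mathcal{S}$. Let $L \subseteq a^*$ be the set of words $w$ with $w\phi \in \mathcal{T}$. Then $L$ is a regular language, and a finite automaton recognizing $L$ can be constructed effectively (from automata for the FA-presentation) given a finite set of words in $a^*$ whose images under $\phi$ form a generating set for $\mathcal{T}$.
   Context: For words $w_1,\dots,w_n$ over a finite alphabet $A$, $\mathrm{conv}(w_1,\dots,w_n)$ is the word over $(A\cup\{\$\})^n$ ($\$$ a new symbol) whose $j$-th letter is the tuple of $j$-th letters of the $w_i$, where words shorter than the longest are padded at the end with $\$$. A relation $R\subseteq (A^* )^n$ is regular if $\{\mathrm{conv}(w_1,\dots,w_n):(w_1,\dots,w_n)\in R\}$ is a regular language. An algebra is regarded as a relational structure by replacing each $k$-ary operation $f$ by its graph, the $(k+1)$-ary relation $\{(x_1,\dots,x_k,(x_1,\dots,x_k)f)\}$. An FA-presentation of a relational structure $\mathcal{S}=(S,R_1,\dots,R_n)$ is a pair $(L,\phi)$ where $L$ is a regular language over a finite alphabet and $\phi:L\to S$ is surjective such that for each $R\in\{=,R_1,\dots,R_n\}$ of arity $r$, the relation $\Lambda(R,\phi)=\{(w_1,\dots,w_r)\in L^r: R(w_1\phi,\dots,w_r\phi)\}$ is regular. It is injective if $\phi$ is injective, and unary if $L$ is over a one-letter alphabet $\{a\}$. *)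

(* Defs.v *)
From mathcomp Require Import all_boot.
From mathcomp Require Import boolp classical_sets functions cardinality.

Set Implicit Arguments.
Unset Strict Implicit.
Unset Printing Implicit Defensive.

Local Open Scope classical_set_scope.

(* A nondeterministic finite automaton is plain finite data; its states are
   the natural numbers that occur in it.  A transition is a triple
   (source, letter, target). *)
Record nfa (X : Type) := NFA {
  nfa_init : seq nat;
  nfa_final : seq nat;
  nfa_trans : seq (nat * X * nat) }.

Fixpoint nfa_run (X : eqType) (M : nfa X) (q : nat) (w : seq X) : bool :=
  if w is x :: w' then
    has (fun t => [&& t.1.1 == q, t.1.2 == x & nfa_run M t.2 w']) (nfa_trans M)
  else q \in nfa_final M.

Definition nfa_accepts (X : eqType) (M : nfa X) (w : seq X) : bool :=
  has (fun q => nfa_run M q w) (nfa_init M).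

Definition recognizes (X : eqType) (M : nfa X) (L : set (seq X)) : Prop :=
  forall w, nfa_accepts M w <-> L w.

Definition regular (X : finType) (L : set (seq X)) : Prop :=
  exists M : nfa X, recognizes M L.

(* [None] is the padding symbol $; [onth s j] is [None] exactly when
   [size s <= j]. *)
Definition conv (A : finType) n (w : n.-tuple (seq A)) :
    seq (n.-tuple (option A)) :=
  mkseq (fun j => [tuple onth (tnth w i) j | i < n])
        (\max_(i < n) size (tnth w i)).

Definition conv_lang (A : finType) n (R : set (n.-tuple (seq A))) :
    set (seq (n.-tuple (option A))) :=
  @conv A n @` R.

Definition regular_rel (A : finType) n (R : set (n.-tuple (seq A))) : Prop :=
  regular (conv_lang R).

Record rel_structure := RelStructure {
  rs_carrier :> Type;
  rs_nrels : nat;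
  rs_arity : 'I_rs_nrels -> nat;
  rs_rel : forall i, set ((rs_arity i).-tuple rs_carrier) }.

Record algebra := Algebra {
  alg_carrier :> Type;
  alg_nops : nat;
  alg_arity : 'I_alg_nops -> nat;
  alg_op : forall i, (alg_arity i).-tuple alg_carrier -> alg_carrier }.

Definition graph S k (f : k.-tuple S -> S) : set (k.+1.-tuple S) :=
  [set [tuple of rcons x (f x)] | x in [set: k.-tuple S]].

Definition alg_structure (S : algebra) : rel_structure :=
  @RelStructure S (alg_nops S) (fun i => (alg_arity i).+1)
    (fun i => graph (@alg_op S i)).

Definition is_subalgebra (S : algebra) (T : set S) : Prop :=
  forall (i : 'I_(alg_nops S)) (x : (alg_arity i).-tuple S),
    (forall j, T (tnth x j)) -> T (alg_op x).

Definition generated (S : algebra) (X : set S) : set S :=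
  smallest (@is_subalgebra S) X.

Definition fg_subalgebra (S : algebra) (T : set S) : Prop :=
  is_subalgebra T /\ exists2 X : set S, finite_set X & T = generated X.

(* phi is a total function on words, but only its values on L matter. *)
Definition Lambda (A : finType) (L : set (seq A)) S (phi : seq A -> S) r
    (R : set (r.-tuple S)) : set (r.-tuple (seq A)) :=
  [set w | (forall i, L (tnth w i)) /\ R [tuple phi (tnth w i) | i < r]].

Definition eq_rel S : set (2.-tuple S) :=
  [set t | tnth t ord0 = tnth t ord_max].

Definition fa_presentation (A : finType) (S : rel_structure)
    (L : set (seq A)) (phi : seq A -> S) : Prop :=
  [/\ regular L,
      set_surj L [set: S] phi,
      regular_rel (Lambda L phi (@eq_rel S)) &
      forall i : 'I_(rs_nrels S), regular_rel (Lambda L phi (@rs_rel S i))].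

Definition injective_fa_presentation (A : finType) (S : rel_structure)
    (L : set (seq A)) (phi : seq A -> S) : Prop :=
  fa_presentation L phi /\ set_inj L phi.

Record fa_automata (A : finType) (n : nat) (ar : 'I_n -> nat) := FAAutomata {
  fa_dom : nfa A;
  fa_eq : nfa (2.-tuple (option A));
  fa_rel : forall i, nfa ((ar i).-tuple (option A)) }.

Definition automata_for (A : finType) (S : rel_structure)
    (L : set (seq A)) (phi : seq A -> S) (M : fa_automata A (@rs_arity S)) :
    Prop :=
  [/\ recognizes (fa_dom M) L,
      recognizes (fa_eq M) (conv_lang (Lambda L phi (@eq_rel S))) &
      forall i, recognizes (fa_rel M i)
                  (conv_lang (Lambda L phi (@rs_rel S i)))].

Inductive recfun : nat -> Type :=
| RZero n : recfun n
| RSucc : recfun 1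
| RProj n : 'I_n -> recfun n
| RComp m n : recfun m -> ('I_m -> recfun n) -> recfun n
| RPrec n : recfun n -> recfun n.+2 -> recfun n.+1
| RMin n : recfun n.+1 -> recfun n.

(* [rec_eval f x y]: f is defined at x, with value y.  The variable of
   primitive recursion and of minimization is the first one. *)
Fixpoint rec_eval n (f : recfun n) : n.-tuple nat -> nat -> Prop :=
  match f in recfun n return n.-tuple nat -> nat -> Prop with
  | RZero _ => fun _ y => y = 0
  | RSucc => fun x y => y = (thead x).+1
  | RProj _ i => fun x y => y = tnth x i
  | RComp m _ g h => fun x y =>
      exists z : m.-tuple nat,
        (forall i, rec_eval (h i) x (tnth z i)) /\ rec_eval g z y
  | RPrec _ g h => fun x =>
      (fix iter (k : nat) : nat -> Prop :=
         if k is k'.+1 then fun y =>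
           exists z, iter k' z /\
             rec_eval h [tuple of k' :: z :: [tuple of behead x]] y
         else rec_eval g [tuple of behead x]) (thead x)
  | RMin _ g => fun x y =>
      rec_eval g [tuple of y :: x] 0 /\
      forall z, z < y -> exists k, rec_eval g [tuple of z :: x] k.+1
  end.

(* The letter a is [tt : unit]; a word a^k is coded by k, and a letter of a
   convolution by the sequence of its components, with a as 1 and $ as 0. *)
Definition code_column r (c : r.-tuple (option unit)) : nat :=
  CodeSeq.code [seq nat_of_bool (isSome x) | x <- c].

Definition code_letter (x : unit) : nat := 1.

Definition code_nfa (X : Type) (code_X : X -> nat) (M : nfa X) : nat :=
  CodeSeq.code
    [:: CodeSeq.code (nfa_init M);
        CodeSeq.code (nfa_final M);
        CodeSeq.code [seq CodeSeq.code [:: t.1.1; code_X t.1.2; t.2]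
                     | t <- nfa_trans M]].

Definition code_input n (ar : 'I_n -> nat) (M : fa_automata unit ar)
    (ws : seq (seq unit)) : nat :=
  CodeSeq.code
    [:: code_nfa code_letter (fa_dom M);
        code_nfa (@code_column 2) (fa_eq M);
        CodeSeq.code
          [seq CodeSeq.code [:: ar i; code_nfa (@code_column (ar i)) (fa_rel M i)]
          | i <- enum 'I_n];
        CodeSeq.code [seq size w | w <- ws]].

(* Main.v *)
Require Import Defs.
From mathcomp Require Import all_boot.
From mathcomp Require Import boolp classical_sets functions cardinality.
From mathcomp Require Import zify.

(* Code the word a^k by k, so that a subalgebra T becomes a set of numbers.
   Let the period e be a common multiple of all lengths of cycles in the
   automata, larger than their sizes and than the arities.  If the arguments and
   the value of an operation leave a gap of length e, the automaton traverses a
   cycle inside it, so everything above the gap can be shifted up by e.  Hence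
   the translation t |-> t + e maps T beyond e into T as soon as it does so on a
   bounded window: a larger element has a gap below it, and the shift transports
   its derivation from the generators.  A pigeonhole argument on windows
   provides such an e, so T is ultimately periodic.

   Effectively, search for e and a list V of elements derived from the
   generators, such that the set U of numbers whose reduction modulo e (beyond
   e) lies in V satisfies, up to an explicit bound, that its elements are in V
   and that it is closed under the operations.  Shifting across gaps extends
   both facts beyond the bound, so that U = T. *)

Set Implicit Arguments.
Unset Strict Implicit.
Unset Printing Implicit Defensive.

Local Open Scope classical_set_scope.

(** * Evaluation of recursive functions *)

(** Relating programs to plain lists avoids casts between tuple lengths; the property is vacuous
    when [size s] differs from [n]. *)
Definition evals n (p : recfun n) (s : seq nat) (y : nat) : Prop :=
  forall t : n.-tuple nat, val t = s -> rec_eval p t y.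

Lemma evals_proj n (i : 'I_n) s : evals (RProj i) s (nth 0 s i).
Proof. by move=> t <- /=; rewrite (tnth_nth 0). Qed.

Lemma evals_succ x : evals RSucc [:: x] x.+1.
Proof. by move=> t et /=; rewrite /thead (tnth_nth 0) et. Qed.

Lemma evals_comp m n (g : recfun m) (h : 'I_m -> recfun n) s u y :
  size u = m -> (forall i : 'I_m, evals (h i) s (nth 0 u i)) ->
  evals g u y -> evals (RComp g h) s y.
Proof.
move=> /eqP su Hh Hg t et; exists (Tuple su); split; last exact: Hg.
by move=> i; rewrite (tnth_nth 0); apply: Hh.
Qed.

(** The trajectory [r] is given in advance, so the step program has to be right only on the values
    actually met. *)
Lemma evals_prec n (g : recfun n) (h : recfun n.+2) s (r : nat -> nat) m :
  evals g s (r 0) ->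
  (forall k, k < m -> evals h [:: k, r k & s] (r k.+1)) ->
  evals (RPrec g h) (m :: s) (r m).
Proof.
move=> Hg Hh t et /=.
have -> : thead t = m by rewrite /thead (tnth_nth 0) et.
have eb : val [tuple of behead t] = s by rewrite /= et.
elim: m Hh {et} => [|m IH] Hh /=; first exact: Hg.
exists (r m); split; first by apply: IH => k km; apply: Hh; apply: ltnW.
by apply: Hh => //=; congr [:: _, _ & _]; exact: eb.
Qed.

Lemma evals_min n (g : recfun n.+1) s m :
  evals g (m :: s) 0 ->
  (forall z, z < m -> exists k, evals g (z :: s) k.+1) ->
  evals (RMin g) s m.
Proof.
move=> H0 H t et; split; first by apply: H0; rewrite /= et.
by move=> z /H[k Hk]; exists k; apply: Hk; rewrite /= et.
Qed.

(** * Arithmetic functions on lists of numbers *)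

Definition raw n (f : seq nat -> nat) : Prop :=
  exists p : recfun n, forall s, size s = n -> evals p s (f s).

Lemma eq_raw n f g : (forall s, size s = n -> f s = g s) -> raw n f -> raw n g.
Proof. by move=> fg [p Hp]; exists p => s sn; rewrite -fg //; apply: Hp. Qed.

Lemma raw_nth n i : i < n -> raw n (nth 0 ^~ i).
Proof. by move=> lt_in; exists (RProj (Ordinal lt_in)) => s _; apply: evals_proj. Qed.

Lemma raw0 n : raw n (fun=> 0).
Proof. by exists (RZero n) => s _ t. Qed.

Lemma raw_comp1 n f g :
  raw 1 g -> raw n f -> raw n (fun s => g [:: f s]).
Proof.
move=> [p Hp] [q Hq]; exists (RComp p (fun=> q)) => s sn.
apply: (@evals_comp _ _ _ _ _ [:: f s]) => //; last exact: Hp.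
by case=> [[|//] ?]; apply: Hq.
Qed.

Lemma raw_comp2 n f1 f2 g :
  raw 2 g -> raw n f1 -> raw n f2 -> raw n (fun s => g [:: f1 s; f2 s]).
Proof.
move=> [p Hp] [q1 H1] [q2 H2]; exists (RComp p (tnth [tuple q1; q2])) => s sn.
apply: (@evals_comp _ _ _ _ _ [:: f1 s; f2 s]) => //; last exact: Hp.
by case=> [[|[|//]] ?]; [apply: H1 | apply: H2].
Qed.

Lemma rawS n f : raw n f -> raw n (fun s => (f s).+1).
Proof.
apply: (@raw_comp1 _ _ (fun s => (nth 0 s 0).+1)).
by exists RSucc => -[|x [|]] //= _; apply: evals_succ.
Qed.

Lemma raw_rec n f g h :
  (forall s, size s = n -> g s 0 = f s) ->
  (forall s k, size s = n -> g s k.+1 = h [:: k, g s k & s]) ->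
  raw n f -> raw n.+2 h ->
  raw n.+1 (fun s => g (behead s) (nth 0 s 0)).
Proof.
move=> g0 gS [p Hp] [q Hq]; exists (RPrec p q) => -[|k s] //= [sn].
apply: evals_prec => [|i _]; first by rewrite g0 //; apply: Hp.
by rewrite gS //; apply: Hq; rewrite /= sn.
Qed.

Lemma raw_pred n f : raw n f -> raw n (fun s => (f s).-1).
Proof.
apply: (@raw_comp1 _ _ (fun s => (nth 0 s 0).-1)).
apply: (@raw_rec 0 (fun=> 0) (fun _ => predn) (nth 0 ^~ 0)) => //.
  exact: raw0.
exact: raw_nth.
Qed.

Lemma raw_sub n f g : raw n f -> raw n g -> raw n (fun s => f s - g s).
Proof.
(* [raw_rec] recurses on the first entry, so the subtrahend is put first. *)
move=> Hf Hg; apply: (@raw_comp2 _ _ _ (fun s => nth 0 s 1 - nth 0 s 0)) Hg Hf.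
apply: eq_raw (@raw_rec 1 (nth 0 ^~ 0) (fun s k => nth 0 s 0 - k)
  (fun s => (nth 0 s 1).-1) _ _ _ _) => //=; first by case=> [|x [|y []]].
- by move=> s; rewrite subn0.
- by move=> s k; rewrite subnS.
- exact: raw_nth.
- exact/raw_pred/raw_nth.
Qed.

Lemma raw_half n f : raw n f -> raw n (fun s => (f s)./2).
Proof.
apply: (@raw_comp1 _ _ (fun s => (nth 0 s 0)./2)).
(* Half of k + 1 is k minus half of k. *)
apply: (@raw_rec 0 (fun=> 0) (fun _ k => k./2) (fun s => nth 0 s 0 - nth 0 s 1)) => //=.
- by move=> s k _; rewrite -{2}(odd_double_half k) uphalf_half; lia.
- exact: raw0.
- by apply: raw_sub; apply: raw_nth.
Qed.

Lemma raw_odd n f : raw n f -> raw n (fun s => nat_of_bool (odd (f s))).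
Proof.
apply: (@raw_comp1 _ _ (fun s => nat_of_bool (odd (nth 0 s 0)))).
apply: (@raw_rec 0 (fun=> 0) (fun _ k => nat_of_bool (odd k)) (fun s => 1 - nth 0 s 1)) => //=.
- by move=> s k _; case: odd.
- exact: raw0.
- by apply: raw_sub; [apply/rawS/raw0 | apply: raw_nth].
Qed.

Lemma raw_double n f : raw n f -> raw n (fun s => (f s).*2).
Proof.
apply: (@raw_comp1 _ _ (fun s => (nth 0 s 0).*2)).
apply: (@raw_rec 0 (fun=> 0) (fun _ k => k.*2) (fun s => (nth 0 s 1).+2)) => //=.
- exact: raw0.
- by apply/rawS/rawS/raw_nth.
Qed.

Lemma raw_shift n f g : raw n f -> raw n g -> raw n (fun s => g s %/ 2 ^ f s).
Proof.
apply: (@raw_comp2 _ _ _ (fun s => nth 0 s 1 %/ 2 ^ nth 0 s 0)).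
apply: eq_raw (@raw_rec 1 (nth 0 ^~ 0) (fun s k => nth 0 s 0 %/ 2 ^ k)
  (fun s => (nth 0 s 1)./2) _ _ _ _) => //=; first by case=> [|x [|y []]].
- by move=> s _; rewrite divn1.
- by move=> s k _; rewrite expnSr divnMA divn2.
- exact: raw_nth.
- exact/raw_half/raw_nth.
Qed.

(* A pair is coded as the head and tail of a list by [CodeSeq.code], so that
   fixed-size lists of codes are nested pairs. *)
Definition epair (a b : nat) : nat := 2 ^ a * b.*2.+1.

Lemma epair_neq0 a b : epair a b != 0.
Proof. by rewrite muln_eq0 expn_eq0. Qed.

Lemma raw_epair n f g : raw n f -> raw n g -> raw n (fun s => epair (f s) (g s)).
Proof.
apply: (@raw_comp2 _ _ _ (fun s => epair (nth 0 s 0) (nth 0 s 1))).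
apply: eq_raw (@raw_rec 1 (fun s => (nth 0 s 0).*2.+1) (fun s k => epair k (nth 0 s 0))
  (fun s => (nth 0 s 1).*2) _ _ _ _) => //=; first by case=> [|x [|y []]].
- by move=> s _; rewrite /epair mul1n.
- by move=> s k _; rewrite /epair expnS -mulnA mul2n.
- exact/rawS/raw_double/raw_nth.
- exact/raw_double/raw_nth.
Qed.

Lemma epair_div a b k : k <= a -> epair a b %/ 2 ^ k = epair (a - k) b.
Proof.
by move=> ka; rewrite -{1}(subnKC ka) /epair expnD -mulnA mulKn ?expn_gt0.
Qed.

(** The first component is the 2-adic valuation of the code, that is, the least shift leaving an odd
    number, and minimization finds it. On the number 0, which codes no pair, this search
    diverges. *)
Lemma evals_efst :
  exists p : recfun 1, forall a b, evals p [:: epair a b] a.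
Proof.
have [p Hp] : raw 2 (fun s => (1 - odd (nth 0 s 1 %/ 2 ^ nth 0 s 0))).
  apply: raw_sub; first exact/rawS/raw0.
  by apply/raw_odd/raw_shift; apply: raw_nth.
exists (RMin p) => a b; apply: evals_min => [|z za].
  have := Hp [:: a; epair a b] erefl; rewrite /= epair_div // subnn.
  by rewrite /epair mul1n /= odd_double.
exists 0; have := Hp [:: z; epair a b] erefl; rewrite /= epair_div 1?ltnW //.
by rewrite /epair -(subnSK za) expnS -mulnA mul2n odd_double.
Qed.

Lemma evals_esnd :
  exists p : recfun 1, forall a b, evals p [:: epair a b] b.
Proof.
have [pf Hf] := evals_efst.
have [p Hp] : raw 2 (fun s => (nth 0 s 1 %/ 2 ^ nth 0 s 0)./2).
  by apply/raw_half/raw_shift; apply: raw_nth.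
exists (RComp p (tnth [tuple pf; RProj ord0])) => a b.
apply: (@evals_comp _ _ _ _ _ [:: a; epair a b]) => //.
  by case=> [[|[|//]] ?]; [apply: Hf | apply: evals_proj].
have := Hp [:: a; epair a b] erefl; rewrite /= epair_div // subnn.
by rewrite /epair mul1n /= uphalf_double.
Qed.

(** * Computable functions on encoded data *)

Class Enc (A : Type) := enc : A -> nat.

#[global] Instance enc_nat : Enc nat := id.
#[global] Instance enc_unit : Enc unit := fun=> 0.
#[global] Instance enc_bool : Enc bool := nat_of_bool.
#[global] Instance enc_prod A B (EA : Enc A) (EB : Enc B) : Enc (A * B) :=
  fun x => epair (enc x.1) (enc x.2).
#[global] Instance enc_seq A (EA : Enc A) : Enc (seq A) :=
  fun s => CodeSeq.code (map enc s).

Definition computable A B {EA : Enc A} {EB : Enc B} (f : A -> B) : Prop :=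
  exists p : recfun 1, forall a, evals p [:: enc a] (enc (f a)).

Lemma eq_computable A B (EA : Enc A) (EB : Enc B) (f g : A -> B) :
  f =1 g -> computable f -> computable g.
Proof. by move=> fg [p Hp]; exists p => a; rewrite -fg. Qed.

Lemma cpt_id A (EA : Enc A) : computable (fun a : A => a).
Proof. by exists (RProj ord0) => a; apply: evals_proj. Qed.

Lemma cpt_comp A B C (EA : Enc A) (EB : Enc B) (EC : Enc C)
  (f : A -> B) (g : B -> C) :
  computable f -> computable g -> computable (fun a => g (f a)).
Proof.
move=> [p Hp] [q Hq]; exists (RComp q (fun=> p)) => a.
apply: (@evals_comp _ _ _ _ _ [:: enc (f a)]) => //.
by case=> [[|//] ?]; apply: Hp.
Qed.

Lemma cpt_cst A B (EA : Enc A) (EB : Enc B) (b : B) : computable (fun _ : A => b).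
Proof.
have [p Hp] : raw 1 (fun=> enc b).
  by elim: (enc b) => [|n IH]; [apply: raw0 | apply: rawS].
by exists p => a; apply: Hp.
Qed.

Lemma cpt_pair A B C (EA : Enc A) (EB : Enc B) (EC : Enc C)
  (f : A -> B) (g : A -> C) :
  computable f -> computable g -> computable (fun a => (f a, g a)).
Proof.
move=> [p Hp] [q Hq].
have [r Hr] : raw 2 (fun s => epair (nth 0 s 0) (nth 0 s 1)).
  by apply: raw_epair; apply: raw_nth.
exists (RComp r (tnth [tuple p; q])) => a.
apply: (@evals_comp _ _ _ _ _ [:: enc (f a); enc (g a)]) => //; last exact: Hr.
by case=> [[|[|//]] ?]; [apply: Hp | apply: Hq].
Qed.

Lemma cpt_fst A B C (EA : Enc A) (EB : Enc B) (EC : Enc C) (f : A -> B * C) :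
  computable f -> computable (fun a => (f a).1).
Proof.
move=> Hf; apply: (@cpt_comp _ _ _ _ _ _ f fst Hf); have [p Hp] := evals_efst.
by exists p => a; apply: Hp.
Qed.

Lemma cpt_snd A B C (EA : Enc A) (EB : Enc B) (EC : Enc C) (f : A -> B * C) :
  computable f -> computable (fun a => (f a).2).
Proof.
move=> Hf; apply: (@cpt_comp _ _ _ _ _ _ f snd Hf); have [p Hp] := evals_esnd.
by exists p => a; apply: Hp.
Qed.

(* The step function is only evaluated below the bound, which makes case
   analysis on a list an instance even though the head of an empty list may
   have no code. *)
Lemma evals_natrec A B (EA : Enc A) (EB : Enc B) (f : A -> nat)
  (r : A -> nat -> B) (ph : recfun 1) :
  computable f -> computable (fun a => r a 0) ->
  (forall a k, k < f a ->
     evals ph [:: epair (enc a) (epair k (enc (r a k)))] (enc (r a k.+1))) ->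
  computable (fun a => r a (f a)).
Proof.
move=> [pf Hf] [pg Hg] Hh.
(* The step of [RPrec] receives counter, value and parameter in this order; [q] packs them into the
   triple that [ph] expects. *)
have [q Hq] : raw 3 (fun s => epair (nth 0 s 2) (epair (nth 0 s 0) (nth 0 s 1))).
  by apply: raw_epair; [|apply: raw_epair]; apply: raw_nth.
exists (RComp (RPrec pg (RComp ph (fun=> q))) (tnth [tuple pf; RProj ord0])) => a.
apply: (@evals_comp _ _ _ _ _ [:: f a; enc a]) => //.
  by case=> [[|[|//]] ?]; [apply: Hf | apply: evals_proj].
apply: (@evals_prec _ _ _ _ (fun k => enc (r a k))) => [|k kf]; first exact: Hg.
apply: (@evals_comp _ _ _ _ _ [:: epair (enc a) (epair k (enc (r a k)))]) => //.
  by case=> [[|//] ?]; apply: Hq.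
exact: Hh.
Qed.

Lemma cpt_natrec A B (EA : Enc A) (EB : Enc B) (f : A -> nat) (g : A -> B)
  (h : A -> nat -> B -> B) :
  computable f -> computable g ->
  computable (fun w : A * (nat * B) => h w.1 w.2.1 w.2.2) ->
  computable (fun a => nat_rect (fun=> B) (g a) (h a) (f a)).
Proof.
move=> Hf Hg [p Hp].
apply: (@evals_natrec _ _ _ _ f (fun a => nat_rect (fun=> B) (g a) (h a)) p) => //.
by move=> a k _; apply: (Hp (a, (k, _))).
Qed.

(** A recursion of length at most one, whose step, if reached, yields the first branch. *)
Lemma cpt_if A B (EA : Enc A) (EB : Enc B) (b : A -> bool) (f g : A -> B) :
  computable b -> computable f -> computable g ->
  computable (fun a => if b a then f a else g a).
Proof.
move=> [pb Hb] Hf Hg.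
have Hb' : computable (fun a => nat_of_bool (b a)) by exists pb.
apply: eq_computable (@cpt_natrec _ _ _ _ _ g (fun a _ _ => f a) Hb' Hg _).
  by move=> a; case: (b a).
exact: cpt_comp (cpt_fst (cpt_id _)) Hf.
Qed.

Lemma cpt_seqcase A B C (EA : Enc A) (EB : Enc B) (EC : Enc C)
  (s : A -> seq B) (f : A -> C) (g : A -> B -> seq B -> C) :
  computable s -> computable f ->
  computable (fun w : A * (B * seq B) => g w.1 w.2.1 w.2.2) ->
  computable (fun a => if s a is x :: s' then g a x s' else f a).
Proof.
move=> [ps Hs] Hf [p Hp].
have Hs' : computable (fun a => enc_seq EB (s a)) by exists ps.
have [pf Hpf] := evals_efst.
have [q Hq] : raw 2 (fun s => epair (nth 0 s 0) (nth 0 s 1)).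
  by apply: raw_epair; apply: raw_nth.
(* The code of a list is 0 exactly when the list is empty, so recursion up to this code ends in the
   right branch. *)
pose r a k := if k is _.+1 then if s a is x :: s' then g a x s' else f a else f a.
(* The step ignores counter and accumulator. The code of a nonempty [s a] is already that of the
   pair of its head and tail. *)
pose pd := RComp p (fun=> RComp q (tnth [tuple pf; RComp ps (fun=> pf)])).
apply: eq_computable (@evals_natrec _ _ _ _ (fun a => enc_seq EB (s a)) r pd _ _ _) => //.
- move=> a; rewrite /r; case: (s a) => [|x s'] //.
  have : enc_seq EB (x :: s') != 0 := epair_neq0 (enc x) (enc_seq EB s').
  by rewrite /enc; case: enc_seq.
move=> a k ka.
have {ka}[x [s' sa]] : exists x s', s a = x :: s'.
  by case: (s a) ka => [|x s'] // _; exists x, s'.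
have -> : r a k.+1 = g a x s' by rewrite /= sa.
apply: (@evals_comp _ _ _ _ _ [:: enc_prod EA (enc_prod EB (enc_seq EB)) (a, (x, s'))]) => //;
  last exact: Hp.
case=> [[|//] ?].
apply: (@evals_comp _ _ _ _ _ [:: enc a; enc_seq EB (s a)]) => //;
  last by rewrite sa; apply: Hq.
case=> [[|[|//]] ?]; first exact: Hpf.
apply: (@evals_comp _ _ _ _ _ [:: enc a]) => //.
by case=> [[|//] ?]; apply: Hpf.
Qed.

Lemma cpt_cons A B (EA : Enc A) (EB : Enc B) (f : A -> B) (g : A -> seq B) :
  computable f -> computable g -> computable (fun a => f a :: g a).
Proof. by move=> Hf Hg; have [p Hp] := cpt_pair Hf Hg; exists p. Qed.

(** Bounds the number of steps of a traversal by a computable number before [size] is known to be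
    computable. *)
Lemma size_le_enc A (EA : Enc A) (s : seq A) : size s <= enc s.
Proof.
elim: s => // x s IH; apply: (@leq_trans (enc_seq EA s).*2.+1).
  by rewrite /= ltnS (leq_trans IH) // -addnn leq_addr.
by rewrite leq_pmull ?expn_gt0.
Qed.

Lemma cpt_foldl A B C (EA : Enc A) (EB : Enc B) (EC : Enc C)
  (s : A -> seq B) (z : A -> C) (h : A -> C -> B -> C) :
  computable s -> computable z ->
  computable (fun w : A * (C * B) => h w.1 w.2.1 w.2.2) ->
  computable (fun a => foldl (h a) (z a) (s a)).
Proof.
move=> Hs Hz Hh.
(* A step consumes the head and is stationary on the empty list, so that iterating beyond the length
   is harmless. *)
pose step a (w : seq B * C) := if w.1 is x :: s' then (s', h a w.2 x) else w.
have Hs' : computable (fun a => enc_seq EB (s a)) by case: Hs => p Hp; exists p.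
pose fin a :=
  (nat_rect (fun=> (seq B * C)%type) (s a, z a) (fun _ => step a) (enc_seq EB (s a))).2.
refine (@eq_computable A C EA EC fin _ _ _).
  move=> a; rewrite /fin; have := size_le_enc EB (s a).
  set n := enc_seq EB (s a).
  have -> k : nat_rect (fun=> (seq B * C)%type) (s a, z a) (fun _ => step a) k
     = (drop k (s a), foldl (h a) (z a) (take k (s a))).
    elim: k (s a) (z a) => [|k IH] t c /=; first by rewrite take0 drop0.
    rewrite IH /step /= -[k.+1]addn1 addnC -drop_drop.
    case Ed: (drop k t) => [|x s'] /=.
      have kt : size t <= k by rewrite -subn_eq0 -size_drop Ed.
      by rewrite !take_oversize // ltnW.
    by rewrite addnC takeD Ed /= take0 foldl_cat drop0.
  by move=> le; rewrite drop_oversize // take_oversize.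
apply/cpt_snd/cpt_natrec => //; first exact: cpt_pair.
apply: (@cpt_seqcase _ _ _ _ _ _ (fun w => w.2.2.1) (fun w => w.2.2)
  (fun w x s' => (s', h w.1 w.2.2.2 x))).
- exact/cpt_fst/cpt_snd/cpt_snd/cpt_id.
- exact/cpt_snd/cpt_snd/cpt_id.
apply: cpt_pair; first exact/cpt_snd/cpt_snd/cpt_id.
apply: (@cpt_comp _ _ _ _ _ _
  (fun v : A * (nat * (seq B * C)) * (B * seq B) => (v.1.1, (v.1.2.2.2, v.2.1))) _ _ Hh).
apply: cpt_pair; first exact/cpt_fst/cpt_fst/cpt_id.
apply: cpt_pair; first exact/cpt_snd/cpt_snd/cpt_snd/cpt_fst/cpt_id.
exact/cpt_fst/cpt_snd/cpt_id.
Qed.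

Lemma cpt_comp2 A B C D (EA : Enc A) (EB : Enc B) (EC : Enc C) (ED : Enc D)
  (f : A -> B) (g : A -> C) (h : B -> C -> D) :
  computable (fun w : B * C => h w.1 w.2) ->
  computable f -> computable g -> computable (fun a => h (f a) (g a)).
Proof. by move=> Hh Hf Hg; apply: cpt_comp (cpt_pair Hf Hg) Hh. Qed.

Lemma cpt_foldr A B C (EA : Enc A) (EB : Enc B) (EC : Enc C)
  (s : A -> seq B) (z : A -> C) (h : A -> B -> C -> C) :
  computable s -> computable z ->
  computable (fun w : A * (C * B) => h w.1 w.2.2 w.2.1) ->
  computable (fun a => foldr (h a) (z a) (s a)).
Proof.
move=> Hs Hz Hh.
have Hrev : computable (fun a => foldl (fun c x => x :: c) [::] (s a)).
  apply: (@cpt_foldl _ _ _ _ _ _ s (fun=> [::]) (fun _ c x => x :: c)) => //.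
    exact: cpt_cst.
  by apply: cpt_cons; [exact/cpt_snd/cpt_snd/cpt_id | exact/cpt_fst/cpt_snd/cpt_id].
apply: eq_computable (@cpt_foldl _ _ _ _ _ _ _ _ (fun a c x => h a x c) Hrev Hz Hh).
move=> a; rewrite -foldl_rev; congr foldl.
by rewrite -[RHS]cats0 -catrevE; elim: (s a) [::] => //= x s' IH t.
Qed.

Ltac cpt_proj := lazymatch goal with
  | |- computable (fun w => w) => exact: cpt_id
  | |- computable fst => exact: (cpt_fst (cpt_id _))
  | |- computable snd => exact: (cpt_snd (cpt_id _))
  | |- computable (fun w => fst (@?f w)) => apply: (@cpt_fst _ _ _ _ _ _ f); cpt_proj
  | |- computable (fun w => snd (@?f w)) => apply: (@cpt_snd _ _ _ _ _ _ f); cpt_proj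
  | |- _ => try assumption
  end.

Lemma cpt_S A (EA : Enc A) (f : A -> nat) :
  computable f -> computable (fun a => (f a).+1).
Proof.
move=> Hf; apply: (@cpt_comp _ _ _ _ _ _ f succn Hf).
by exists RSucc => n; apply: evals_succ.
Qed.

Lemma cpt_iter A C (EA : Enc A) (EC : Enc C) (f : A -> nat) (h : A -> C -> C) (z : A -> C) :
  computable f -> computable z ->
  computable (fun w : A * C => h w.1 w.2) ->
  computable (fun a => iter (f a) (h a) (z a)).
Proof.
move=> Hf Hz Hh.
apply: eq_computable (@cpt_natrec _ _ _ _ f z (fun a _ => h a) Hf Hz _).
  by move=> a; elim: (f a) => //= n ->.
by apply: (cpt_comp2 Hh); cpt_proj.
Qed.

Lemma cpt_add A (EA : Enc A) (f g : A -> nat) :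
  computable f -> computable g -> computable (fun a => f a + g a).
Proof.
move=> Hf Hg; apply: eq_computable (@cpt_iter _ _ _ _ f (fun=> succn) g Hf Hg _).
  by move=> a; rewrite iter_succn addnC.
by apply: cpt_S; cpt_proj.
Qed.

Lemma cpt_mul A (EA : Enc A) (f g : A -> nat) :
  computable f -> computable g -> computable (fun a => f a * g a).
Proof.
move=> Hf Hg; apply: eq_computable (@cpt_iter _ _ _ _ f (fun a => addn (g a)) (fun=> 0) Hf _ _).
- by move=> a; rewrite iter_addn_0 mulnC.
- exact: cpt_cst.
- by apply: cpt_add; cpt_proj; apply: (@cpt_comp _ _ _ _ _ _ fst g) => //; cpt_proj.
Qed.

Lemma cpt_sub A (EA : Enc A) (f g : A -> nat) :
  computable f -> computable g -> computable (fun a => f a - g a).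
Proof.
move=> Hf Hg; apply: eq_computable (@cpt_iter _ _ _ _ g (fun=> predn) f Hg Hf _).
  by move=> a; rewrite iter_predn.
apply: eq_computable (@cpt_natrec _ _ _ _ snd (fun=> 0) (fun _ k _ => k) _ _ _); cpt_proj.
- by case=> a [].
- exact: cpt_cst.
Qed.

Lemma cpt_leq A (EA : Enc A) (f g : A -> nat) :
  computable f -> computable g -> computable (fun a => f a <= g a).
Proof.
move=> Hf Hg; apply: eq_computable
  (@cpt_natrec _ _ _ _ (fun a => f a - g a) (fun=> true) (fun _ _ _ => false) _ _ _).
- by move=> a; rewrite /leq; case: subn.
- exact: cpt_sub.
- exact: cpt_cst.
- exact: cpt_cst.
Qed.

Lemma cpt_andb A (EA : Enc A) (b c : A -> bool) :
  computable b -> computable c -> computable (fun a => b a && c a).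
Proof.
by move=> Hb Hc; apply: (@cpt_if _ _ _ _ b c (fun=> false)) => //; apply: cpt_cst.
Qed.

Lemma cpt_orb A (EA : Enc A) (b c : A -> bool) :
  computable b -> computable c -> computable (fun a => b a || c a).
Proof.
by move=> Hb Hc; apply: (@cpt_if _ _ _ _ b (fun=> true) c) => //; apply: cpt_cst.
Qed.

Lemma cpt_implyb A (EA : Enc A) (b c : A -> bool) :
  computable b -> computable c -> computable (fun a => b a ==> c a).
Proof.
by move=> Hb Hc; apply: (@cpt_if _ _ _ _ b c (fun=> true)) => //; apply: cpt_cst.
Qed.

Lemma cpt_nat_of_bool A (EA : Enc A) (b : A -> bool) :
  computable b -> computable (fun a => nat_of_bool (b a)).
Proof. by case=> p Hp; exists p. Qed.

Lemma cpt_eqn A (EA : Enc A) (f g : A -> nat) :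
  computable f -> computable g -> computable (fun a => f a == g a).
Proof.
move=> Hf Hg; apply: eq_computable (cpt_andb (cpt_leq Hf Hg) (cpt_leq Hg Hf)).
by move=> a; rewrite eqn_leq.
Qed.

Lemma cpt_code A (EA : Enc A) (s : A -> seq nat) :
  computable s -> computable (fun a => CodeSeq.code (s a)).
Proof. by case=> p Hp; exists p => a; have := Hp a; rewrite /enc /enc_seq /= map_id. Qed.

Lemma cpt_decode A (EA : Enc A) (f : A -> nat) :
  computable f -> computable (fun a => CodeSeq.decode (f a)).
Proof.
by case=> p Hp; exists p => a; rewrite {2}/enc /enc_seq map_id CodeSeq.decodeK; apply: Hp.
Qed.

Lemma cpt_eqseqn A (EA : Enc A) (s t : A -> seq nat) :
  computable s -> computable t -> computable (fun a => s a == t a).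
Proof.
move=> Hs Ht; apply: eq_computable (cpt_eqn (cpt_code Hs) (cpt_code Ht)) => a.
by rewrite (can_eq CodeSeq.codeK).
Qed.

Lemma cpt_map A B C (EA : Enc A) (EB : Enc B) (EC : Enc C)
  (s : A -> seq B) (h : A -> B -> C) :
  computable s -> computable (fun w : A * B => h w.1 w.2) ->
  computable (fun a => map (h a) (s a)).
Proof.
move=> Hs Hh; apply: eq_computable (@cpt_foldr _ _ _ _ _ _ s (fun=> [::])
  (fun a x c => h a x :: c) Hs _ _).
- by move=> a; elim: (s a) => //= x u ->.
- exact: cpt_cst.
- by apply: cpt_cons; [apply: (cpt_comp2 Hh) | idtac]; cpt_proj.
Qed.

Lemma cpt_filter A B (EA : Enc A) (EB : Enc B) (s : A -> seq B) (h : A -> B -> bool) :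
  computable s -> computable (fun w : A * B => h w.1 w.2) ->
  computable (fun a => filter (h a) (s a)).
Proof.
move=> Hs Hh; apply: eq_computable (@cpt_foldr _ _ _ _ _ _ s (fun=> [::])
  (fun a x c => if h a x then x :: c else c) Hs _ _).
- by move=> a; elim: (s a) => //= x u ->.
- exact: cpt_cst.
- apply: cpt_if; [apply: (cpt_comp2 Hh) | apply: cpt_cons | idtac]; cpt_proj.
Qed.

Lemma cpt_has A B (EA : Enc A) (EB : Enc B) (s : A -> seq B) (h : A -> B -> bool) :
  computable s -> computable (fun w : A * B => h w.1 w.2) ->
  computable (fun a => has (h a) (s a)).
Proof.
move=> Hs Hh; apply: (@cpt_foldr _ _ _ _ _ _ s (fun=> false) (fun a x c => h a x || c)) => //.
- exact: cpt_cst.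
- by apply: cpt_orb; [apply: (cpt_comp2 Hh) | idtac]; cpt_proj.
Qed.

Lemma cpt_all A B (EA : Enc A) (EB : Enc B) (s : A -> seq B) (h : A -> B -> bool) :
  computable s -> computable (fun w : A * B => h w.1 w.2) ->
  computable (fun a => all (h a) (s a)).
Proof.
move=> Hs Hh; apply: (@cpt_foldr _ _ _ _ _ _ s (fun=> true) (fun a x c => h a x && c)) => //.
- exact: cpt_cst.
- by apply: cpt_andb; [apply: (cpt_comp2 Hh) | idtac]; cpt_proj.
Qed.

Lemma cpt_size A B (EA : Enc A) (EB : Enc B) (s : A -> seq B) :
  computable s -> computable (fun a => size (s a)).
Proof.
move=> Hs; apply: (@cpt_foldr _ _ _ _ _ _ s (fun=> 0) (fun _ _ => succn)) => //.
- exact: cpt_cst.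
- by apply: cpt_S; cpt_proj.
Qed.

Lemma cpt_cat A B (EA : Enc A) (EB : Enc B) (s t : A -> seq B) :
  computable s -> computable t -> computable (fun a => s a ++ t a).
Proof.
move=> Hs Ht; apply: eq_computable (@cpt_foldr _ _ _ _ _ _ s t (fun=> cons) Hs Ht _).
- by move=> a; elim: (s a) => //= x u ->.
- by apply: cpt_cons; cpt_proj.
Qed.

Lemma cpt_rcons A B (EA : Enc A) (EB : Enc B) (s : A -> seq B) (f : A -> B) :
  computable s -> computable f -> computable (fun a => rcons (s a) (f a)).
Proof.
move=> Hs Hf; apply: eq_computable (cpt_cat Hs (cpt_cons Hf (cpt_cst _ _ [::]))).
by move=> a; rewrite cats1.
Qed.

Lemma cpt_behead A B (EA : Enc A) (EB : Enc B) (s : A -> seq B) :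
  computable s -> computable (fun a => behead (s a)).
Proof.
move=> Hs; apply: (@cpt_seqcase _ _ _ _ _ _ s (fun=> [::]) (fun _ _ t => t)) => //.
- exact: cpt_cst.
- by cpt_proj.
Qed.

Lemma cpt_head A B (EA : Enc A) (EB : Enc B) (x : B) (s : A -> seq B) :
  computable s -> computable (fun a => head x (s a)).
Proof.
move=> Hs; apply: (@cpt_seqcase _ _ _ _ _ _ s (fun=> x) (fun _ y _ => y)) => //.
- exact: cpt_cst.
- by cpt_proj.
Qed.

Lemma cpt_flatten A B (EA : Enc A) (EB : Enc B) (s : A -> seq (seq B)) :
  computable s -> computable (fun a => flatten (s a)).
Proof.
move=> Hs; apply: (@cpt_foldr _ _ _ _ _ _ s (fun=> [::]) (fun=> cat)) => //.
- exact: cpt_cst.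
- by apply: cpt_cat; cpt_proj.
Qed.

Lemma cpt_mem A (EA : Enc A) (f : A -> nat) (s : A -> seq nat) :
  computable f -> computable s -> computable (fun a => f a \in s a).
Proof.
move=> Hf Hs; apply: eq_computable (@cpt_has _ _ _ _ s (fun a x => x == f a) Hs _).
  by move=> a; rewrite has_pred1.
by apply: cpt_eqn; cpt_proj; apply: (@cpt_comp _ _ _ _ _ _ fst f) => //; cpt_proj.
Qed.

Lemma cpt_iota A (EA : Enc A) (f g : A -> nat) :
  computable f -> computable g -> computable (fun a => iota (f a) (g a)).
Proof.
move=> Hf Hg.
pose r a (k : nat) (u : seq nat) := rcons u (f a + k).
have Hr : computable (fun a => nat_rect (fun=> seq nat) [::] (r a) (g a)).
  apply: cpt_natrec => //; first exact: cpt_cst.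
  apply: cpt_rcons; cpt_proj; apply: cpt_add; cpt_proj.
  by apply: (@cpt_comp _ _ _ _ _ _ fst f) => //; cpt_proj.
apply: eq_computable Hr => a; elim: (g a) => // n IH.
by rewrite -[in RHS]addn1 iotaD cats1 -IH.
Qed.

(* Partiality of minimization is confined to inputs without a witness. *)
Lemma computable_search A B (EA : Enc A) (EB : Enc B)
  (test : A * nat -> bool) (out : A * nat -> B) :
  computable test -> computable out ->
  exists p : recfun 1, forall a, (exists c, test (a, c)) ->
    exists c, test (a, c) /\ forall t : 1.-tuple nat, val t = [:: enc a] ->
      rec_eval p t (enc (out (a, c))).
Proof.
move=> Ht [po Ho].
have [pt Hpt] : computable (fun w => 1 - nat_of_bool (test w)).
  by apply: cpt_sub; [apply: cpt_cst | apply: cpt_nat_of_bool].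
have [q Hq] : raw 2 (fun s => epair (nth 0 s 1) (nth 0 s 0)).
  by apply: raw_epair; apply: raw_nth.
have [q' Hq'] : raw 2 (fun s => epair (nth 0 s 0) (nth 0 s 1)).
  by apply: raw_epair; apply: raw_nth.
pose pm := RMin (RComp pt (fun=> q)).
exists (RComp po (fun=> RComp q' (tnth [tuple RProj ord0; pm]))) => a ex_c.
case: (ex_minnP ex_c) => c tc min_c; exists c; split=> //.
have Hpt' z : evals (RComp pt (fun=> q)) [:: z; enc a] (1 - nat_of_bool (test (a, z))).
  apply: (@evals_comp _ _ _ _ _ [:: epair (enc a) z]) => //; last exact: (Hpt (a, z)).
  by case=> [[|//] ?]; apply: Hq.
apply: (@evals_comp _ _ _ _ _ [:: epair (enc a) c]) => //; last exact: (Ho (a, c)).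
case=> [[|//] ?]; apply: (@evals_comp _ _ _ _ _ [:: enc a; c]) => //; last exact: Hq'.
case=> [[|[|//]] ?]; first exact: evals_proj.
apply: evals_min => [|z zc]; first by have := Hpt' c; rewrite tc.
exists 0; have := Hpt' z; case tz: (test (a, z)) => //.
by have := min_c z tz; rewrite leqNgt zc.
Qed.

(** * The decision procedure *)

(* The [unit] components end nested pairs, so that the coding of the data of an
   automaton is that of [code_nfa]. *)
Definition transition : Type := nat * (seq nat * (nat * unit)).

Definition autom : Type := seq nat * (seq nat * (seq transition * unit)).

Definition relation : Type := nat * (autom * unit).

Definition trans (M : autom) := M.2.2.1.

Definition step (tr : seq transition) (Q c : seq nat) : seq nat :=
  [seq t.2.2.1 | t <- tr & (t.1 \in Q) && (t.2.1 == c)].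

Definition accepts (M : autom) (w : seq (seq nat)) : bool :=
  has (fun q => q \in M.2.1) (foldl (step (trans M)) M.1 w).

(** The [j]-th letter of the convolution of the words a^l for l in [v], with a coded by 1 and
    padding by 0. *)
Definition column (v : seq nat) (j : nat) : seq nat := [seq nat_of_bool (j < l) | l <- v].

Definition maxs (v : seq nat) := foldr (fun m n => if m < n then n else m) 0 v.

Definition columns (v : seq nat) : seq (seq nat) := [seq column v j | j <- iota 0 (maxs v)].

Definition holds (M : autom) (v : seq nat) : bool := accepts M (columns v).

Definition tuples (k : nat) (s : seq nat) : seq (seq nat) :=
  iter k (fun acc => flatten [seq [seq x :: t | t <- acc] | x <- s]) [:: [::]].

Definition justified (rels : seq relation) (gens acc : seq nat) (y : nat) :=
  (y \in gens) ||
  has (fun r => has (fun x => holds r.2.1 (rcons x y)) (tuples r.1 acc)) rels.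

(** The list [V] is read as a candidate derivation. Whatever it is, only elements of the subalgebra
    are kept, so the search may guess it blindly. *)
Definition saturate rels gens (V : seq nat) : seq nat :=
  foldl (fun acc y => if justified rels gens acc y then y :: acc else acc) [::] V.

(** The transitions of a lasso with a tail of length [e] and a cycle of length [e]. *)
Definition next_state e j := if j.+1 < e + e then j.+1 else e.

(* The remainder of [u] modulo [e] in [e, 2e), or [u] itself below [e]; it is the
   state that the output automaton reaches on a^u. *)
Definition red e u := iter u (next_state e) 0.

Definition member e (V : seq nat) u := red e u \in V.

(* Room above [e] for [k + 1] gaps of length [3e] when [k + 2 <= e], and for the
   window on which translation by [e] is tested. *)
Definition bound e := 4 * e * e.

(** Distinct states on a cycle are targets of distinct transitions, so the number of transitions
    bounds the length of a simple cycle. Divisibility is written as a bounded search for the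
    quotient. *)
Definition admissible e (r : relation) :=
  [&& r.1.+2 <= e, (size (trans r.2.1)).+1 <= e &
      all (fun j => has (fun q => q * j == e) (iota 0 e.+1))
        (iota 1 (size (trans r.2.1)).+1)].

(** Values are sought in the finite list [V], since they may exceed the bound on the arguments. *)
Definition closed_op e V (r : relation) :=
  all (fun x => has (fun y => holds r.2.1 (rcons x y) && member e V y) V)
    (tuples r.1 [seq u <- iota 0 (bound e).+1 | member e V u]).

Definition check rels gens e V :=
  [&& 0 < e, all (fun g => (g \in V) && (g <= e)) gens,
      all (fun r => admissible e r && closed_op e V r) rels &
      all (fun u => member e V u ==> (u \in V)) (iota 0 (bound e).+1)].

Definition input : Type :=
  nat * (nat * (seq relation * (seq nat * unit))).

(* The input lists the arities of the graphs of the operations. *)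
Definition rels_of (a : input) := [seq (r.1 - 1, r.2) | r <- a.2.2.1].
Definition gens_of (a : input) := a.2.2.2.1.
(** A candidate [c] codes a list whose head is the period and whose tail is the derivation. *)
Definition period_of (c : nat) := head 0 (CodeSeq.decode c).
Definition elements_of (w : input * nat) :=
  saturate (rels_of w.1) (gens_of w.1) (behead (CodeSeq.decode w.2)).

Definition test (w : input * nat) : bool :=
  check (rels_of w.1) (gens_of w.1) (period_of w.2) (elements_of w).

Definition output (w : input * nat) :
    seq nat * (seq nat * (seq (nat * (nat * (nat * unit))) * unit)) :=
  let e := period_of w.2 in
  ([:: 0], ([seq u <- iota 0 (e + e) | u \in elements_of w],
   ([seq (j, (1, (next_state e j, tt))) | j <- iota 0 (e + e)], tt))).

(* [cpt] recurses on the body of a function; [cpt_user] is redefined as more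
   computable functions become available. *)
Ltac cpt_user := fail.

Ltac cpt := cbv beta; lazymatch goal with
  | |- computable (fun _ => ?b) => exact: cpt_cst
  | |- computable (fun w => w) => exact: cpt_id
  | |- computable fst => exact: (cpt_fst (cpt_id _))
  | |- computable snd => exact: (cpt_snd (cpt_id _))
  | |- computable (fun w => fst (@?f w)) => apply: (@cpt_fst _ _ _ _ _ _ f); cpt
  | |- computable (fun w => snd (@?f w)) => apply: (@cpt_snd _ _ _ _ _ _ f); cpt
  | |- computable (fun w => pair (@?f w) (@?g w)) =>
      apply: (@cpt_pair _ _ _ _ _ _ f g); cpt
  | |- computable (fun w => S (@?f w)) => apply: (@cpt_S _ _ f); cpt
  | |- computable (fun w => addn (@?f w) (@?g w)) => apply: (@cpt_add _ _ f g); cpt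
  | |- computable (fun w => muln (@?f w) (@?g w)) => apply: (@cpt_mul _ _ f g); cpt
  | |- computable (fun w => subn (@?f w) (@?g w)) => apply: (@cpt_sub _ _ f g); cpt
  | |- computable (fun w => leq (@?f w) (@?g w)) => apply: (@cpt_leq _ _ f g); cpt
  | |- computable (fun w => andb (@?f w) (@?g w)) => apply: (@cpt_andb _ _ f g); cpt
  | |- computable (fun w => orb (@?f w) (@?g w)) => apply: (@cpt_orb _ _ f g); cpt
  | |- computable (fun w => implb (@?f w) (@?g w)) => apply: (@cpt_implyb _ _ f g); cpt
  | |- computable (fun w => nat_of_bool (@?f w)) => apply: (@cpt_nat_of_bool _ _ f); cpt
  | |- computable (fun w => (@?f w) == (@?g w)) =>
      first [apply: (@cpt_eqn _ _ f g) | apply: (@cpt_eqseqn _ _ f g)]; cpt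
  | |- computable (fun w => (@?f w) \in (@?g w)) => apply: (@cpt_mem _ _ f g); cpt
  | |- computable (fun w => cons (@?f w) (@?g w)) => apply: (@cpt_cons _ _ _ _ f g); cpt
  | |- computable (fun w => rcons (@?f w) (@?g w)) => apply: (@cpt_rcons _ _ _ _ f g); cpt
  | |- computable (fun w => size (@?f w)) => apply: (@cpt_size _ _ _ _ f); cpt
  | |- computable (fun w => behead (@?f w)) => apply: (@cpt_behead _ _ _ _ f); cpt
  | |- computable (fun w => head ?x (@?f w)) => apply: (@cpt_head _ _ _ _ x f); cpt
  | |- computable (fun w => flatten (@?f w)) => apply: (@cpt_flatten _ _ _ _ f); cpt
  | |- computable (fun w => iota (@?f w) (@?g w)) => apply: (@cpt_iota _ _ f g); cpt
  | |- computable (fun w => CodeSeq.decode (@?f w)) => apply: (@cpt_decode _ _ f); cpt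
  | |- computable (fun w => map (@?h w) (@?s w)) =>
      apply: (@cpt_map _ _ _ _ _ _ s h); cpt
  | |- computable (fun w => filter (@?h w) (@?s w)) =>
      apply: (@cpt_filter _ _ _ _ s h); cpt
  | |- computable (fun w => has (@?h w) (@?s w)) => apply: (@cpt_has _ _ _ _ s h); cpt
  | |- computable (fun w => all (@?h w) (@?s w)) => apply: (@cpt_all _ _ _ _ s h); cpt
  | |- computable (fun w => foldl (@?h w) (@?z w) (@?s w)) =>
      apply: (@cpt_foldl _ _ _ _ _ _ s z h); cpt
  | |- computable (fun w => foldr (@?h w) (@?z w) (@?s w)) =>
      apply: (@cpt_foldr _ _ _ _ _ _ s z h); cpt
  | |- computable (fun w => iter (@?f w) (@?h w) (@?z w)) =>
      apply: (@cpt_iter _ _ _ _ f h z); cpt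
  | |- _ => cpt_user
  end.

Ltac cpt_user ::= first [assumption | apply: cpt_if; cpt].

(** * Computability of the decision procedure *)

Lemma cpt_step : computable (fun w : seq transition * (seq nat * seq nat) =>
  step w.1 w.2.1 w.2.2).
Proof. by rewrite /step; cpt. Qed.

Lemma cpt_columns : computable columns.
Proof. by rewrite /columns /column /maxs; cpt. Qed.

Lemma cpt_tuples : computable (fun w : nat * seq nat => tuples w.1 w.2).
Proof. by rewrite /tuples; cpt. Qed.

Lemma cpt_next_state : computable (fun w : nat * nat => next_state w.1 w.2).
Proof. by rewrite /next_state; cpt. Qed.

Ltac cpt_user ::= lazymatch goal with
  | |- computable (fun w => step (@?f w) (@?g w) (@?h w)) =>
      refine (@cpt_comp2 _ _ _ _ _ _ _ _ f (fun w => (g w, h w))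
        (fun t v => step t v.1 v.2) cpt_step _ _); cpt
  | |- computable (fun w => columns (@?f w)) =>
      refine (@cpt_comp _ _ _ _ _ _ f columns _ cpt_columns); cpt
  | |- computable (fun w => tuples (@?f w) (@?g w)) =>
      refine (@cpt_comp2 _ _ _ _ _ _ _ _ f g tuples cpt_tuples _ _); cpt
  | |- computable (fun w => next_state (@?f w) (@?g w)) =>
      refine (@cpt_comp2 _ _ _ _ _ _ _ _ f g next_state cpt_next_state _ _); cpt
  | |- _ => first [assumption | apply: cpt_if; cpt]
  end.

Lemma cpt_holds : computable (fun w : autom * seq nat => holds w.1 w.2).
Proof. by rewrite /holds /accepts /trans; cpt. Qed.

Lemma cpt_member : computable (fun w : (nat * seq nat) * nat => member w.1.1 w.1.2 w.2).
Proof. by rewrite /member /red; cpt. Qed.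

Ltac cpt_user ::= lazymatch goal with
  | |- computable (fun w => holds (@?f w) (@?g w)) =>
      refine (@cpt_comp2 _ _ _ _ _ _ _ _ f g holds cpt_holds _ _); cpt
  | |- computable (fun w => member (@?e w) (@?v w) (@?u w)) =>
      refine (@cpt_comp2 _ _ _ _ _ _ _ _ (fun w => (e w, v w)) u
        (fun t => member t.1 t.2) cpt_member _ _); cpt
  | |- computable (fun w => tuples (@?f w) (@?g w)) =>
      refine (@cpt_comp2 _ _ _ _ _ _ _ _ f g tuples cpt_tuples _ _); cpt
  | |- computable (fun w => next_state (@?f w) (@?g w)) =>
      refine (@cpt_comp2 _ _ _ _ _ _ _ _ f g next_state cpt_next_state _ _); cpt
  | |- _ => first [assumption | apply: cpt_if; cpt]
  end.

Lemma cpt_elements : computable elements_of.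
Proof. by rewrite /elements_of /saturate /justified /rels_of /gens_of; cpt. Qed.

Lemma cpt_period : computable period_of.
Proof. by rewrite /period_of; cpt. Qed.

Lemma cpt_check : computable
  (fun w : seq relation * (seq nat * (nat * seq nat)) =>
   check w.1 w.2.1 w.2.2.1 w.2.2.2).
Proof. by rewrite /check /closed_op /admissible /bound /trans; cpt. Qed.

Lemma cpt_test : computable test.
Proof.
apply: (@cpt_comp _ _ _ _ _ _ (fun w => (rels_of w.1, (gens_of w.1,
  (period_of w.2, elements_of w)))) _ _ cpt_check).
rewrite /rels_of /gens_of.
apply: cpt_pair; first by cpt.
apply: cpt_pair; first by cpt.
by apply: cpt_pair; [apply: cpt_comp cpt_period; cpt | exact: cpt_elements].
Qed.

Lemma cpt_output : computable output.
Proof.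
rewrite /output.
have He : computable (fun w : input * nat => period_of w.2).
  by apply: cpt_comp cpt_period; cpt.
have H : computable (fun w : nat * seq nat =>
  ([:: 0], ([seq u <- iota 0 (w.1 + w.1) | u \in w.2],
   ([seq (j, (1, (next_state w.1 j, tt))) | j <- iota 0 (w.1 + w.1)], tt)))).
  by cpt.
exact: (cpt_comp (cpt_pair He cpt_elements) H).
Qed.

(** * Pumping and ultimate periodicity *)

Definition edge (tr : seq transition) (c : seq nat) : rel nat :=
  fun p q => has (fun t => [&& t.1 == p, t.2.1 == c & t.2.2.1 == q]) tr.

Lemma mem_step tr Q c q :
  reflect (exists2 p, p \in Q & edge tr c p q) (q \in step tr Q c).
Proof.
apply: (iffP mapP) => [[t]|[p pQ /hasP[t tr_t /and3P[/eqP tp /eqP tc /eqP tq]]]].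
  rewrite mem_filter => /andP[/andP[tQ tc] tr_t] ->; exists t.1 => //.
  by apply/hasP; exists t; rewrite // !eqxx tc.
by exists t; rewrite // mem_filter tp pQ tc eqxx.
Qed.

(** On a block of equal letters a run is a path in the graph of one letter, where cycles can be cut
    out and repeated. *)
Lemma mem_foldl_step_nseq tr Q c n q :
  reflect (exists p s, [/\ p \in Q, path (edge tr c) p s, size s = n & last p s = q])
    (q \in foldl (step tr) Q (nseq n c)).
Proof.
elim: n Q => [|n IH] Q /=.
  apply: (iffP idP) => [qQ|[p [s [pQ _ /size0nil -> <-]]]] //.
  by exists q, [::].
apply: (iffP (IH _)) => [[p [s [/mem_step[p' p'Q e] ps sn lst]]]|[p [[|p' s] [pQ]]]] //.
  by exists p', (p :: s); rewrite /= e sn.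
move=> /= /andP[e ps] [sn] lst; exists p', s; split=> //.
by apply/mem_step; exists p.
Qed.

Lemma foldl_step_sub tr Q Q' w :
  {subset Q <= Q'} -> {subset foldl (step tr) Q w <= foldl (step tr) Q' w}.
Proof.
elim: w Q Q' => //= c w IH Q Q' QQ'; apply: IH => q /mem_step[p pQ e].
by apply/mem_step; exists p => //; apply: QQ'.
Qed.

(** A path with more steps than there are transitions revisits a state. The length of the cycle in
    between divides [e], so repeating the cycle suitably often lengthens the path by exactly [e]. *)
Lemma foldl_step_pump tr Q c e :
  (forall j, 0 < j <= size tr -> j %| e) ->
  {subset foldl (step tr) Q (nseq (size tr).+1 c)
       <= foldl (step tr) Q (nseq ((size tr).+1 + e) c)}.
Proof.
move=> div_e q /mem_foldl_step_nseq[p [s [pQ ps sn lst]]].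
(* The start [p] need not be the target of a transition, so the repetition is sought in [s]; hence
   the one extra letter in the block. *)
have s_tgt : {subset s <= [seq t.2.2.1 | t <- tr]}.
  elim: s p ps {pQ sn lst} => //= x s IH p /andP[/hasP[t tr_t /and3P[_ _ /eqP tx]] xs] y.
  rewrite inE => /predU1P[->|/(IH _ xs)//]; by rewrite -tx; apply: map_f.
have : ~~ uniq s.
  by apply/negP => /uniq_leq_size/(_ s_tgt); rewrite size_map sn ltnn.
move=> /(uniqPn 0)[i [j [ij js nij]]].
have [s1 [l [s3 [es sl ll]]]] : exists s1 l s3, [/\ s = s1 ++ l ++ s3,
    size l = j - i & last (last p s1) l = last p s1].
  exists (take i.+1 s), (take (j - i) (drop i.+1 s)), (drop (j - i) (drop i.+1 s)).
  have it : i.+1 <= size s by apply: leq_trans ij (ltnW js).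
  rewrite cat_take_drop cat_take_drop; split=> //.
    by rewrite size_takel // size_drop -(subSS i j) leq_sub2r.
  have lt k : k < size s -> last p (take k.+1 s) = nth 0 s k.
    move=> ks; rewrite (last_nth 0) size_takel //= nth_take //.
  have -> : last (last p (take i.+1 s)) (take (j - i) (drop i.+1 s)) = last p (take j.+1 s).
    by rewrite -last_cat -takeD addSn subnKC // ltnW.
  by rewrite !lt.
have /dvdnP[k ek] : size l %| e.
  by apply: div_e; rewrite sl subn_gt0 ij (leq_trans (leq_subr _ _)) // -ltnS -sn.
move: ps lst; rewrite es !cat_path !last_cat ll => /and3P[p1 pl p3] lst.
apply/mem_foldl_step_nseq; exists p, (s1 ++ flatten (nseq k l) ++ l ++ s3).
have [pk lk] : path (edge tr c) (last p s1) (flatten (nseq k l)) /\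
    last (last p s1) (flatten (nseq k l)) = last p s1.
  by elim: k {ek} => //= k [IH1 IH2]; rewrite cat_path last_cat ll pl.
split=> //; first by rewrite !cat_path lk ll p1 pk pl.
  rewrite -sn es !size_cat ek size_flatten /shape map_nseq sumn_nseq; lia.
by rewrite !last_cat lk ll.
Qed.

Lemma accepts_pump M a b c e :
  (forall j, 0 < j <= size (trans M) -> j %| e) ->
  accepts M (a ++ nseq (size (trans M)).+1 c ++ b) ->
  accepts M (a ++ nseq ((size (trans M)).+1 + e) c ++ b).
Proof.
move=> div_e /hasP[q qM qf]; apply/hasP; exists q => //.
move: qM; rewrite !foldl_cat; apply: foldl_step_sub; exact: foldl_step_pump.
Qed.

Lemma leq_maxs v u : u \in v -> u <= maxs v.
Proof.
elim: v => //= x v IH; rewrite inE => /predU1P[->|/IH]; case: ltnP; lia.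
Qed.

Lemma maxs_in v : v != [::] -> maxs v \in v.
Proof.
elim: v => //= x [|y v] IH _; first by rewrite ltn0 inE.
by rewrite inE; case: ifP => _; rewrite ?eqxx // IH ?orbT.
Qed.

Definition shift g e u := if u <= g then u else u + e.

Lemma maxs_shift v g e u :
  u \in v -> g < u -> maxs (map (shift g e) v) = maxs v + e.
Proof.
move=> uv gu; have v0 : v != [::] by case: v uv.
apply/eqP; rewrite eqn_leq; apply/andP; split.
  have /maxs_in/mapP[x /leq_maxs xv ->] : map (shift g e) v != [::] by case: v v0 uv.
  by rewrite /shift; case: ifP; lia.
have -> : maxs v + e = shift g e (maxs v).
  by rewrite /shift leqNgt (leq_trans gu) // leq_maxs.
by apply/leq_maxs/map_f/maxs_in.
Qed.

(** Inside the gap all columns are equal, with 1 for the entries above it and 0 for the others.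
    Pumping this block by [e] produces the columns of the shifted tuple. *)
Lemma holds_shift M v g n e :
  size (trans M) < n -> (forall j, 0 < j <= size (trans M) -> j %| e) ->
  (forall u, u \in v -> u <= g \/ g + n <= u) ->
  holds M v -> holds M (map (shift g e) v).
Proof.
move=> Mn div_e gap.
have [/hasP[u uv gu]|/hasPn low] := boolP (has (fun u => g < u) v); last first.
  suff -> : map (shift g e) v = v by [].
  by apply: map_id_in => u /low; rewrite /shift -leqNgt => ->.
have gnm : g + n <= maxs v.
  by case: (gap u uv) => [|h]; [rewrite leqNgt gu | apply: leq_trans h (leq_maxs uv)].
have eqcol (f : nat -> nat) j j' :
    (forall x : nat, x \in v -> (j < x) = (j' < f x)) -> column v j = column (map f v) j'.
  by move=> h; rewrite /column -map_comp; apply/eq_in_map => x /h /= ->.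
have cst (f : nat -> seq nat) c m k : (forall j, m <= j < m + k -> f j = c) ->
    [seq f j | j <- iota m k] = nseq k c.
  elim: k m => //= k IH m h; rewrite h ?leqnn /=; last lia.
  by rewrite IH // => j hj; apply: h; lia.
rewrite /holds /columns (maxs_shift _ uv gu).
(* Only the first [n0] columns of the gap are pumped; the [k] columns after them reappear [e] places
   later. *)
set n0 := (size (trans M)).+1; set k := maxs v - (g + n0).
have n0n : n0 <= n by [].
have -> : maxs v = g + (n0 + k) by rewrite /k; lia.
have -> : g + (n0 + k) + e = g + (n0 + e + k) by lia.
rewrite (iotaD 0 g (n0 + k)) (iotaD 0 g (n0 + e + k)) add0n.
rewrite (iotaD g n0 k) (iotaD g (n0 + e) k) !map_cat.
have -> : [seq column v j | j <- iota 0 g] = [seq column (map (shift g e) v) j | j <- iota 0 g].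
  apply/eq_in_map => /= j; rewrite mem_iota => jg; apply: eqcol => x xv.
  by rewrite /shift; case: (leqP x g); lia.
pose c := column v g.
rewrite (cst _ c g n0); last first.
  by move=> j hj; rewrite /c -[v in RHS]map_id; apply: eqcol => x /gap h; lia.
rewrite (cst _ c g (n0 + e)); last first.
  move=> j hj; rewrite /c; apply/esym/eqcol => x /gap h.
  by rewrite /shift; case: (leqP x g); lia.
have -> : [seq column v j | j <- iota (g + n0) k] =
    [seq column (map (shift g e) v) j | j <- iota (g + (n0 + e)) k].
  rewrite addnA (addnC _ e) (iotaDl e) -map_comp; apply/eq_in_map => /= j.
  rewrite mem_iota => hj /=; apply: eqcol => x /gap h.
  by rewrite /shift; case: (leqP x g); lia.
exact: accepts_pump.
Qed.

Lemma exists_gap (x : seq nat) a d z : a + size x * d + d <= z ->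
  exists g, [/\ a <= g, g + d <= z & forall u, u \in x -> u <= g \/ g + d <= u].
Proof.
elim: {x}(size x) {-2}x (leqnn (size x)) a => [|n IH] x xn a az.
  by exists a; split=> [//||u]; [lia | case: x xn {az}].
have [/hasP/=[u ux /andP[au ud]]|/hasPn low] :=
  boolP (has (fun u => a < u < a + d) x); last first.
  by exists a; split=> //; [nia | move=> u /low; lia].
have sr : (size (rem u x)).+1 = size x by rewrite size_rem // prednK //; case: (x) ux.
have [||g [ag gz gap]] := IH (rem u x) _ (a + d).
- by move: xn; rewrite -sr.
- by move: az; rewrite -sr mulSn !addnA.
exists g; split=> //; first lia.
move=> t tx; have [-> //|tu] := eqVneq t u; first by left; lia.
by apply: gap; move: (perm_mem (perm_to_rem ux) t); rewrite tx inE (negbTE tu).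
Qed.

Lemma mem_tuples k s x : (x \in tuples k s) = (size x == k) && all (mem s) x.
Proof.
elim: k x => [|k IH] [|y x] //=.
  by apply/negbTE/negP => /flatten_mapP[z _ /mapP[]].
apply/flatten_mapP/idP => [[z zs /mapP[t]]|/andP[sx /andP[ys xs]]].
  by rewrite IH => /andP[/eqP <- ts] [-> ->]; rewrite eqxx /= zs.
by exists y => //; apply: map_f; rewrite IH -eqSS sx.
Qed.

Lemma redS e u : red e u.+1 = next_state e (red e u). Proof. by []. Qed.

Lemma red_id e u : u < e + e -> red e u = u.
Proof.
elim: u => // u IH ue; rewrite redS IH; last exact: ltnW.
by rewrite /next_state ue.
Qed.

Lemma red_addr e u : 0 < e -> e <= u -> red e (u + e) = red e u.
Proof.
move=> e0 /subnKC <-; elim: (u - e) => [|k IH]; last by rewrite addnS addSn !redS IH.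
rewrite addn0 (@red_id e e); last lia.
have -> : e + e = (e + e).-1.+1 by lia.
by rewrite redS red_id /next_state; [case: ltnP; lia | lia].
Qed.

Lemma red_lt e u : 0 < e -> red e u < e + e.
Proof.
move=> e0; case: u => [|u]; first by rewrite addn_gt0 e0.
by rewrite redS /next_state; case: ifP => //; lia.
Qed.

Lemma foldl_saturate_sub rels (gens : seq nat) (P : nat -> Prop) (acc V : seq nat) :
  (forall (acc : seq nat) y, (forall u : nat, u \in acc -> P u) ->
     justified rels gens acc y -> P y) ->
  (forall u : nat, u \in acc -> P u) ->
  forall u : nat,
    u \in foldl (fun acc y => if justified rels gens acc y then y :: acc else acc) acc V ->
    P u.
Proof.
move=> H; elim: V acc => //= y V IH acc Pacc; apply: IH; case: ifP => // jy u.
by rewrite inE => /predU1P[->|/Pacc //]; apply: H jy.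
Qed.

(** Makes the sum of the arguments a termination measure when large arguments are shifted down. *)
Lemma sumn_map_lt (f : nat -> nat) (x : seq nat) (z : nat) :
  (forall u : nat, u \in x -> f u <= u) -> z \in x -> f z < z ->
  sumn (map f x) < sumn x.
Proof.
elim: x => //= u x IH le_f; rewrite inE => /predU1P[<-|zx] lt_f.
  have : sumn (map f x) <= sumn x; last lia.
  have : forall u : nat, u \in x -> f u <= u.
    by move=> t tx; apply: le_f; rewrite inE tx orbT.
  elim: (x) => //= t y IHy h; apply: leq_add; first by apply: h; rewrite mem_head.
  by apply: IHy => v vy; apply: h; rewrite inE vy orbT.
have := le_f u (mem_head _ _).
have : sumn (map f x) < sumn x; last lia.
by apply: IH => // t tx; apply: le_f; rewrite inE tx orbT.
Qed.

Lemma list_choice (X : eqType) (Y : eqType) (Q : X -> Y -> Prop) (s : seq X) :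
  (forall x, x \in s -> exists y, Q x y) ->
  exists t : seq Y, forall x, x \in s -> exists2 y, y \in t & Q x y.
Proof.
elim: s => [|x s IH] H; first by exists [::].
have [y Qy] := H x (mem_head _ _).
have [|t Ht] := IH; first by move=> z zs; apply: H; rewrite inE zs orbT.
exists (y :: t) => z; rewrite inE => /predU1P[->|/Ht[w wt Qw]].
  by exists y; rewrite ?mem_head.
by exists w; rewrite // inE wt orbT.
Qed.

(** * Soundness and completeness of the check for a generated set of numbers *)

Section Core.
Variables (rels : seq relation) (gens : seq nat) (T : nat -> Prop).
Hypothesis T_gens : forall g : nat, g \in gens -> T g.
Hypothesis T_op : forall r (x : seq nat) (y : nat), r \in rels -> size x = r.1 ->
  (forall u : nat, u \in x -> T u) -> holds r.2.1 (rcons x y) -> T y.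
Hypothesis T_ind : forall P : nat -> Prop, (forall g : nat, g \in gens -> P g) ->
  (forall r (x : seq nat) (y : nat), r \in rels -> size x = r.1 ->
     (forall u : nat, u \in x -> P u) -> holds r.2.1 (rcons x y) -> P y) ->
  forall u, T u -> P u.
Hypothesis op_total : forall r (x : seq nat), r \in rels -> size x = r.1 ->
  exists y, holds r.2.1 (rcons x y).
Hypothesis op_fun : forall r (x : seq nat) (y y' : nat), r \in rels -> size x = r.1 ->
  holds r.2.1 (rcons x y) -> holds r.2.1 (rcons x y') -> y = y'.

Lemma saturate_sub V u : u \in saturate rels gens V -> T u.
Proof.
apply: foldl_saturate_sub => // acc y Tacc /orP[/T_gens //|/hasP[r rr /hasP[x]]].
rewrite mem_tuples => /andP[/eqP sx /allP xacc].
by apply: T_op => // t tx; apply/Tacc/xacc.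
Qed.

Let F acc y := if justified rels gens acc y then y :: acc else acc.

Let F_mono (acc V : seq nat) : {subset acc <= foldl F acc V}.
Proof.
elim: V acc => [|y V IH] acc u ua //=; apply: IH; rewrite /F; case: ifP => // _.
by rewrite inE ua orbT.
Qed.

(** Since the hypothesis allows every start [acc], derivations of single elements can be run one
    after the other. *)
Let F_list (L acc : seq nat) :
  (forall u : nat, u \in L -> forall acc, exists V, u \in foldl F acc V) ->
  exists V, {subset L <= foldl F acc V}.
Proof.
elim: L acc => [|u L IH] acc H; first by exists [::].
have [V uV] := H u (mem_head _ _) acc.
have [|V' LV] := IH (foldl F acc V); first by move=> t tL; apply: H; rewrite inE tL orbT.
exists (V ++ V') => t; rewrite foldl_cat inE => /predU1P[->|/LV //].
exact: F_mono.
Qed.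

Lemma saturate_complete (L : seq nat) : (forall u : nat, u \in L -> T u) ->
  exists V, {subset L <= saturate rels gens V}.
Proof.
move=> TL; apply: F_list => u /TL; elim/T_ind: u / => [g gg|r x y rr sx IH h] acc.
  by exists [:: g]; rewrite /= /F /justified gg mem_head.
have [V xV] := F_list acc IH; exists (rcons V y).
rewrite foldl_rcons {1}/F ifT ?mem_head //; apply/orP; right.
apply/hasP; exists r => //; apply/hasP; exists x => //.
by rewrite mem_tuples sx eqxx; apply/allP.
Qed.

(* Up to [N + W] the translates are given; beyond, the arguments and the value
   of an operation leave a gap above [N], across which they can be shifted. *)
Lemma translate_closed N W d E :
  (forall r, r \in rels -> [/\ size (trans r.2.1) < d, r.1.+2 * d <= W &
     forall j, 0 < j <= size (trans r.2.1) -> j %| E]) ->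
  (forall g : nat, g \in gens -> g <= N + W) ->
  (forall t, T t -> N <= t <= N + W -> T (t + E)) ->
  forall t, T t -> N <= t -> T (t + E).
Proof.
move=> Hr Hg base t Tt.
(* Membership in [T] is kept in the induction because arguments below the gap are not shifted. *)
suff: T t /\ (N <= t -> T (t + E)) by case.
elim/T_ind: t / Tt => [g gg|r x y rr sx IH h].
  by split=> [|Ng]; [apply: T_gens | apply: base (T_gens gg) _; rewrite Ng Hg].
have Ty : T y by apply: T_op h => // u /IH[].
split=> // Ny; have [yW|Wy] := leqP y (N + W); first by apply: base; rewrite // Ny.
have [Md rW dv] := Hr r rr.
(* The gap is sought below [y], so that the shift moves the value. *)
have [|g [Ng gy gap]] := @exists_gap x N d y; first by rewrite sx; nia.
have yE : y + E = shift g E y by rewrite /shift leqNgt (_ : g < y) //; lia.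
rewrite yE; apply: (T_op (x := map (shift g E) x) rr); first by rewrite size_map.
  move=> _ /mapP[u ux ->]; have [Tu TuE] := IH u ux; rewrite /shift; case: leqP => // gu.
  by apply: TuE; lia.
rewrite -map_rcons; apply: (holds_shift Md dv) h => u.
by rewrite mem_rcons inE => /predU1P[->|/gap //]; right.
Qed.

(** Let U be the set given by [member e V]. Closure of U under the operations puts [T] inside U by
    induction. Conversely, up to the bound U lies in [V], hence in [T]; so translation by [e]
    preserves [T] on a window, then everywhere above [e], and U lies in [T]. *)
Lemma check_sound e V0 : check rels gens e (saturate rels gens V0) ->
  forall u, T u <-> member e (saturate rels gens V0) u.
Proof.
set V := saturate rels gens V0 => /and4P[e0 /allP gV /allP rV /allP perV].
have VT u : u \in V -> T u by apply: saturate_sub.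
have adm r : r \in rels -> [/\ size (trans r.2.1) < e, r.1.+2 <= e &
    forall j, 0 < j <= size (trans r.2.1) -> j %| e].
  move=> /rV/andP[/and3P[H1 H2 /allP H3] _]; split=> // j /andP[j0 js].
  have /H3/hasP[q _ /eqP <-] : j \in iota 1 (size (trans r.2.1)).+1.
    by rewrite mem_iota j0 add1n ltnS leqW.
  exact: dvdn_mull.
have per u : u <= bound e -> member e V u -> u \in V.
  by move=> ub mu; have /perV : u \in iota 0 (bound e).+1; rewrite ?mem_iota // mu.
have member_addr u : e <= u -> member e V (u + e) = member e V u.
  by move=> eu; rewrite /member red_addr.
have bnd : e + e <= bound e by rewrite /bound; nia.
(* By induction on the sum of the arguments. Below an argument beyond the bound there is a gap of
   length 3e; moving everything above it down by [e] leaves a gap of length 2e, enough to shift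
   back. *)
have clo r (x : seq nat) : r \in rels -> size x = r.1 ->
    (forall u : nat, u \in x -> member e V u) ->
    exists2 y, holds r.2.1 (rcons x y) & member e V y.
  move=> rr; have [Hs Har dv] := adm r rr.
  have [n] := ubnP (sumn x); elim: n x => // n IH x /ltnSE xn sx mx.
  have [/allP small|] := boolP (all (fun u => u <= bound e) x).
    have /rV/andP[_ /allP/(_ x)] := rr; rewrite mem_tuples sx eqxx.
    have -> : all (mem [seq u <- iota 0 (bound e).+1 | member e V u]) x.
      apply/allP => u ux; apply: (_ : u \in _).
      by rewrite mem_filter mx // mem_iota add0n ltnS small.
    by move=> /(_ isT)/hasP[y yV /andP[hy my]]; exists y.
  case/allPn => /= z zx; rewrite -ltnNge => zb.
  have [|g [eg gz gap]] := @exists_gap x e (3 * e) z.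
    by rewrite sx; move: zb; rewrite /bound; nia.
  pose x' := map (fun u => if u <= g then u else u - e) x.
  (* The value [y'] at the arguments shifted down lies on one side of the middle
     of the gap; shift back up, leaving [y'] fixed or moving it by [e]. *)
  have [|||y' hy' my'] := IH x'.
  - apply: leq_trans xn; apply: sumn_map_lt zx _ => [u _|]; first by case: ifP; lia.
    by case: ifP; lia.
  - by rewrite size_map.
  - move=> _ /mapP[/= u ux ->]; case: ifP => [_|gu]; first exact: mx.
    have h : g + 3 * e <= u by case: (gap u ux) => // /negPf; rewrite gu.
    by rewrite -member_addr ?subnK; [exact: mx | lia | lia].
  have shift_x' g' : g <= g' <= g + e -> map (shift g' e) x' = x.
    move=> hg'; rewrite -map_comp -[RHS]map_id; apply/eq_in_map => /= u /gap h.
    by rewrite /shift; case: (leqP u g); case: ifP; lia.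
  have gap' g' : g <= g' <= g + e -> forall u : nat, u \in x' -> u <= g' \/ g' + e <= u.
    by move=> hg' _ /mapP[/= u /gap h ->]; case: ifP; lia.
  have [y'g|gy'] := leqP y' (g + e).
    exists y' => //.
    have := @holds_shift _ (rcons x' y') (g + e) e e Hs dv _ hy'.
    rewrite map_rcons shift_x' ?leqnn ?leq_addr // /shift y'g; apply=> u.
    by rewrite mem_rcons inE => /predU1P[->|/gap']; [left | apply; rewrite ?leqnn ?leq_addr].
  exists (y' + e); last by rewrite member_addr //; lia.
  have := @holds_shift _ (rcons x' y') g e e Hs dv _ hy'.
  rewrite map_rcons shift_x' ?leqnn ?leq_addr // /shift leqNgt (_ : g < y') /=; last lia.
  apply=> u; rewrite mem_rcons inE => /predU1P[->|/gap']; first by right; lia.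
  by apply; rewrite leqnn leq_addr.
have TU u : T u -> member e V u.
  elim/T_ind: u / => [g /gV/andP[gV' ge]|r x y rr sx mx h].
    by rewrite /member red_id //; lia.
  by have [y' h' my'] := clo r x rr sx mx; rewrite (op_fun rr sx h h').
(* The window ends at [bound e - e], so that the translates of its elements still respect the
   bound. *)
have up t : T t -> e <= t -> T (t + e).
  apply: (@translate_closed e (bound e - 2 * e) e e) => [r rr|g /gV/andP[_ ge]|s Ts hs].
  - by have [H1 H2 H3] := adm r rr; split=> //; rewrite /bound; nia.
  - by lia.
  - by apply/VT/per; [lia | rewrite member_addr; [apply: TU | lia]].
move=> u; split; first exact: TU.
have [n] := ubnP u; elim: n u => // n IH u /ltnSE un mu.
have [ue|eu] := ltnP u (e + e); first by apply: VT; rewrite -(red_id ue).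
have -> : u = (u - e) + e by lia.
apply: up; last lia.
by apply: IH; [lia | rewrite -member_addr ?subnK; [| lia | lia]].
Qed.

(** Two windows carry the same pattern of [T], so translation by their distance [E] preserves [T] on
    the first one and, by [translate_closed], everywhere beyond its start. Membership is then
    eventually constant along each residue class modulo [E]. *)
Lemma eventually_periodic e0 : 0 < e0 ->
  (forall g : nat, g \in gens -> g <= e0) ->
  (forall r, r \in rels -> [/\ size (trans r.2.1) < e0, r.1.+2 <= e0 &
     forall j, 0 < j <= size (trans r.2.1) -> j %| e0]) ->
  exists e, [/\ 0 < e, e0 %| e & forall u, e <= u -> T u <-> T (u + e)].
Proof.
move=> e0_gt0 Hg Hr; pose W := e0 * e0.
(* Windows start at multiples of [e0], which makes their distance a multiple of [e0], as pumping
   requires. *)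
pose pat i : {ffun 'I_W.+1 -> bool} := [ffun k : 'I_W.+1 => `[< T (i * e0 + k) >]].
pose n := #|{ffun 'I_W.+1 -> bool}|.
have [i [j [ij pij]]] : exists i j, i < j /\ pat i = pat j.
  have /injectivePn[a [b ab pab]] : ~~ injectiveb (fun a : 'I_n.+1 => pat a).
    by apply/injectiveP => /leq_card; rewrite card_ord ltnn.
  by case: (ltngtP a b) ab => [ab _|ba _|/val_inj ->]; [exists a, b|exists b, a|rewrite eqxx].
pose N := i * e0; pose E := (j - i) * e0.
have E0 : 0 < E by rewrite muln_gt0 subn_gt0 ij.
have dE : e0 %| E by apply: dvdn_mull.
have base t : T t -> N <= t <= N + W -> T (t + E).
  move=> Tt /andP[Nt tW]; have kW : t - N < W.+1 by lia.
  have := congr1 (fun f : {ffun 'I_W.+1 -> bool} => f (Ordinal kW)) pij.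
  rewrite !ffunE /= -/N subnKC // => H.
  have -> : t + E = j * e0 + (t - N) by rewrite /E /N; nia.
  by apply/asboolP; rewrite -H; apply/asboolP.
have up t : T t -> N <= t -> T (t + E).
  apply: (@translate_closed N W e0 E) base t => [r rr|g /Hg ge].
    have [H1 H2 H3] := Hr r rr; split=> //; first by rewrite leq_mul2r H2 orbT.
    by move=> k /H3 /dvdn_trans; apply.
  by rewrite /W; nia.
have upk k t : T t -> N <= t -> T (t + k * E).
  move=> Tt Nt; elim: k => [|k IH]; rewrite ?addn0 // mulSn addnCA addnC.
  by apply: up => //; lia.
(* A class with a member beyond [N] consists of members from there on; otherwise it has none beyond
   [N]. *)
have /fin_all_exists[m Hm] (r : 'I_E) : exists m, forall u, m <= u -> u %% E = r ->
    T u <-> T (u + E).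
  have [[t [Nt tr Tt]]|none] := EM (exists t, [/\ N <= t, t %% E = r & T t]).
    exists t => u tu ur.
    suff Tu : T u by split=> // _; apply: up => //; apply: leq_trans tu.
    have /dvdnP[k ek] : E %| u - t by rewrite -eqn_mod_dvd // ur tr.
    by rewrite -(subnKC tu) ek; apply: upk.
  exists N => u Nu ur; split=> Tu; case: none; [exists u | exists (u + E)]; split=> //.
    by rewrite (leq_trans Nu) ?leq_addr.
  by rewrite modnDr.
pose M := \max_r m r.
have perE u : M <= u -> T u <-> T (u + E).
  move=> Mu; apply: (Hm (Ordinal (ltn_pmod u E0))) => //.
  exact: leq_trans (leq_bigmax _) Mu.
(* The factor [M.+1] lifts the period above the threshold [M]. *)
exists (M.+1 * E); split; [by rewrite muln_gt0 E0 | by apply: dvdn_mull | move=> u eu].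
have Mu : M <= u by nia.
elim: (M.+1) => [|k IH]; first by rewrite addn0.
rewrite IH (_ : u + k.+1 * E = u + k * E + E); last by rewrite mulSn; lia.
by apply: perE; rewrite (leq_trans Mu) ?leq_addr.
Qed.

(** For a true period [e], let the derivation reach the generators, the elements of [T] up to the
    bound and the values of the operations at these. Then [member e V] is [T] and every test
    succeeds. *)
Lemma check_complete : exists e V0, check rels gens e (saturate rels gens V0).
Proof.
(* The factorial of [m] is a multiple of all relevant cycle lengths and dominates sizes, arities and
   generators. *)
pose m := (\max_(r <- rels) (size (trans r.2.1) + r.1.+2)) + (sumn gens).+1.
have m_le : m <= m`! by apply: fact_geq.
have gens_le (g : nat) : g \in gens -> g <= m`!.
  move=> gg; apply: leq_trans m_le; have : g <= sumn gens; last by rewrite /m; lia.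
  by elim: gens gg => //= x s IH; rewrite inE => /predU1P[->|/IH]; lia.
have rels_le r : r \in rels -> size (trans r.2.1) + r.1.+2 <= m.
  by move=> rr; apply: leq_trans (leq_addr _ _); apply: (@leq_bigmax_seq _ rels xpredT).
have [||r rr|e [e_gt0 de per]] := @eventually_periodic m`!; rewrite ?fact_gt0 //.
  have := rels_le r rr; split; [lia | lia | move=> j hj].
  by apply: dvdn_fact; lia.
have m_e : m`! <= e by apply: dvdn_leq.
have Tred u : T u <-> T (red e u).
  have [n] := ubnP u; elim: n u => // n IH u /ltnSE un.
  have [ue|eu] := ltnP u (e + e); first by rewrite red_id.
  have -> : u = (u - e) + e by lia.
  by rewrite red_addr -?per -?IH //; lia.
pose small := [seq u <- iota 0 (bound e).+1 | `[< T u >]].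
have smallT u : u \in small -> T u by rewrite mem_filter => /andP[/asboolP].
pose P := [seq (r, x) | r <- rels, x <- tuples r.1 small].
have [|ys Hys] := @list_choice _ _ (fun p y => holds p.1.2.1 (rcons p.2 y) /\ T y) P.
  move=> _ /allpairsPdep[r [x [rr xt ->]]]; move: xt.
  rewrite mem_tuples => /andP[/eqP sx /allP xs].
  have [y hy] := op_total rr sx; exists y; split=> //.
  by apply: T_op hy => // u /xs/smallT.
have [|V0] := @saturate_complete (gens ++ small ++ [seq y <- ys | `[< T y >]]).
  by move=> u; rewrite !mem_cat (mem_filter _ _ ys) => /or3P[/T_gens|/smallT|/andP[/asboolP]].
set V := saturate rels gens V0 => LV.
have bnd : e + e <= bound e by rewrite /bound; nia.
have small_in u : u <= bound e -> T u -> u \in V.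
  move=> ub Tu; apply: LV; rewrite !mem_cat (mem_filter _ _ (iota _ _)) mem_iota add0n ltnS ub.
  by move/asboolP: Tu => ->; rewrite orbT.
have memberE u : member e V u = `[< T u >].
  apply/idP/asboolP => [mu|/Tred Tr]; first by apply/Tred/(@saturate_sub V0).
  by apply: small_in Tr; rewrite (leq_trans _ bnd) // ltnW // red_lt.
exists e, V0; apply/and4P; split=> //.
- apply/allP => g gg; rewrite LV ?mem_cat ?gg //=.
  exact: leq_trans (gens_le g gg) m_e.
- apply/allP => r rr; have rm := rels_le r rr; apply/andP; split.
    have rs : (size (trans r.2.1)).+1 <= m by apply: leq_trans rm; rewrite addnS ltnS leq_addr.
    have me : m <= e := leq_trans m_le m_e.
    apply/and3P; split; [|exact: leq_trans me|apply/allP => j].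
      by apply: leq_trans me; apply: leq_trans rm; apply: leq_addl.
    rewrite mem_iota add1n ltnS => /andP[j0 js]; have /dvdnP[q eq] : j %| e.
      by apply: dvdn_trans de; apply: dvdn_fact; rewrite j0 (leq_trans js).
    by apply/hasP; exists q; rewrite ?mem_iota eq ?eqxx // add0n ltnS leq_pmulr.
  rewrite /closed_op (eq_filter memberE) -/small; apply/allP => x xt.
  have [|y yys /= [hy Ty]] := Hys (r, x); first by apply/allpairsPdep; exists r, x.
  apply/hasP; exists y; last by rewrite hy memberE; apply/asboolP.
  by apply: LV; rewrite !mem_cat (mem_filter _ _ ys) yys andbT (asboolT Ty) !orbT.
- apply/allP => u; rewrite mem_iota add0n ltnS memberE => /andP[_ ub].
  by apply/implyP => /asboolP; apply: small_in.
Qed.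

End Core.

(** * Automata of a presentation *)

Lemma pmap_onth (A : Type) (s : seq A) N : size s <= N -> pmap (onth s) (iota 0 N) = s.
Proof.
elim: s N => [|x s IH] [|N] //= sN; first by elim: (iota 1 N) => //= j t ->; case: j.
have -> m k : pmap (onth (x :: s)) (iota m.+1 k) = pmap (onth s) (iota m k).
  by elim: k m => //= k IHk m; rewrite IHk.
by rewrite IH.
Qed.

(** Dropping the padding from a component recovers the word. Acceptance of a convolution can thus be
    read back as a fact about the tuple. *)
Lemma conv_inj (A : finType) n : injective (@conv A n).
Proof.
move=> w1 w2 e12; apply: eq_from_tnth => i.
have rec (w : n.-tuple (seq A)) : pmap (fun c => tnth c i) (conv w) = tnth w i.
  rewrite /conv /mkseq -[RHS](@pmap_onth _ _ (\max_(i < n) size (tnth w i))).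
    by elim: (iota _ _) => //= j s ->; rewrite tnth_mktuple.
  exact: (leq_bigmax i).
by rewrite -!rec e12.
Qed.

Definition letter_column r (c : r.-tuple (option unit)) : seq nat :=
  [seq nat_of_bool (isSome x) | x <- c].

Lemma letter_column_inj r : injective (@letter_column r).
Proof.
move=> c d /inj_map e; apply/val_inj/e => -[[]|] [[]|] //.
Qed.

Definition raw_autom r (M : nfa (r.-tuple (option unit))) : autom :=
  (nfa_init M, (nfa_final M,
   ([seq (t.1.1, (letter_column t.1.2, (t.2, tt))) | t <- nfa_trans M], tt))).

Lemma accepts_raw_autom r (M : nfa (r.-tuple (option unit))) w :
  accepts (raw_autom M) (map (@letter_column r) w) = nfa_accepts M w.
Proof.
rewrite /accepts /nfa_accepts /=; elim: w (nfa_init M) => //= c w IH Q.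
rewrite IH; apply/hasP/hasP => [[q /mem_step[p pQ]]|[p pQ /hasP[t tM]]].
  rewrite /edge has_map => /hasP[t tM /= /and3P[/eqP tp /eqP/letter_column_inj tc /eqP <-]] run.
  by exists p => //; apply/hasP; exists t => //; rewrite tp tc !eqxx.
case/and3P => /eqP tp /eqP tc run; exists t.2 => //; apply/mem_step; exists p => //.
by rewrite /edge has_map; apply/hasP; exists t => //=; rewrite tp tc !eqxx.
Qed.

Lemma columns_conv r (w : r.-tuple (seq unit)) :
  columns (map size w) = map (@letter_column r) (conv w).
Proof.
rewrite /columns /conv /mkseq -map_comp.
have -> : maxs (map size w) = \max_(i < r) size (tnth w i).
  rewrite -(big_tuple _ _ w xpredT size) /=.
  elim: (tval w) => [|u s IH]; first by rewrite big_nil.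
  by rewrite big_cons /= -IH /maxn.
apply: eq_map => j; rewrite /column /letter_column /= -!map_comp.
rewrite -{1}(map_tnth_enum w) -map_comp; rewrite enumT; apply: eq_map => i /=.
by rewrite onthTE.
Qed.

Lemma word_size (w : seq unit) : w = nseq (size w) tt.
Proof. by elim: w => //= -[] w {1}->. Qed.

(** * The output automaton and the coding of inputs *)

Definition period_nfa e (V : seq nat) : nfa unit :=
  NFA [:: 0] [seq u <- iota 0 (e + e) | u \in V]
    [seq (j, tt, next_state e j) | j <- iota 0 (e + e)].

Lemma period_nfa_accepts e V w : 0 < e ->
  nfa_accepts (period_nfa e V) w = member e V (size w).
Proof.
move=> e0; rewrite /nfa_accepts /= orbF /member.
have run q : q < e + e ->
    nfa_run (period_nfa e V) q w = (iter (size w) (next_state e) q \in V).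
  elim: w q => [|[] w IH] q qe /=; first by rewrite mem_filter mem_iota leq0n add0n qe !andbT.
  rewrite -iterS iterSr -IH; last by rewrite /next_state; case: ifP => //; lia.
  rewrite has_map; apply/hasP/idP => [[j _ /= /andP[/eqP -> //]]|run].
  by exists q; rewrite ?mem_iota //= !eqxx.
by rewrite run // addn_gt0 e0.
Qed.

Lemma enc_seq_nat (s : seq nat) : enc s = CodeSeq.code s.
Proof. by rewrite /enc /enc_seq map_id. Qed.

Lemma code_nfaE X (code_X : X -> nat) (M : nfa X) (Y : Type) (EY : Enc Y)
    (f : nat * X * nat -> Y) :
  (forall t, enc (f t) = CodeSeq.code [:: t.1.1; code_X t.1.2; t.2]) ->
  enc (nfa_init M, (nfa_final M, ([seq f t | t <- nfa_trans M], tt))) = code_nfa code_X M.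
Proof.
move=> Hf.
(* Nested pairs closed by [tt] have, by conversion, the code of the list of their components. *)
rewrite -[LHS]/(epair (enc (nfa_init M)) (epair (enc (nfa_final M)) (epair (enc_seq EY _) 0))).
by rewrite !enc_seq_nat /enc_seq -map_comp (eq_map Hf).
Qed.

Lemma enc_raw_autom r (M : nfa (r.-tuple (option unit))) :
  enc (raw_autom M) = code_nfa (@code_column r) M.
Proof.
apply: code_nfaE => t.
rewrite -[LHS]/(epair t.1.1 (epair (enc (letter_column t.1.2)) (epair t.2 0))).
by rewrite enc_seq_nat.
Qed.

Lemma enc_period_nfa e V :
  enc ([:: 0], ([seq u <- iota 0 (e + e) | u \in V],
   ([seq (j, (1, (next_state e j, tt))) | j <- iota 0 (e + e)], tt))) =
  code_nfa code_letter (period_nfa e V).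
Proof.
rewrite -(@code_nfaE _ _ _ _ _ (fun t => (t.1.1, (1, (t.2, tt))))) //=.
by rewrite -map_comp.
Qed.

Definition raw_rels n (ar : 'I_n -> nat) (M : fa_automata unit ar) :
    seq relation :=
  [seq (ar i, (raw_autom (fa_rel M i), tt)) | i <- enum 'I_n].

Definition raw_input n (ar : 'I_n -> nat) (M : fa_automata unit ar)
    (ws : seq (seq unit)) : input :=
  (code_nfa code_letter (fa_dom M), (code_nfa (@code_column 2) (fa_eq M),
   (raw_rels M, (map size ws, tt)))).

Lemma enc_raw_input n (ar : 'I_n -> nat) (M : fa_automata unit ar) ws :
  enc (raw_input M ws) = code_input M ws.
Proof.
rewrite -[LHS]/(epair (code_nfa code_letter (fa_dom M))
  (epair (code_nfa (@code_column 2) (fa_eq M))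
  (epair (enc (raw_rels M)) (epair (enc (map size ws)) 0)))).
rewrite enc_seq_nat {1}/enc /enc_seq /raw_rels -map_comp /code_input.
rewrite (@eq_map _ _ _ (fun i => CodeSeq.code
  [:: ar i; code_nfa (@code_column (ar i)) (fa_rel M i)])) // => i.
rewrite -[LHS]/(epair (ar i) (epair (enc (raw_autom (fa_rel M i))) 0)).
by rewrite enc_raw_autom.
Qed.

Local Notation word k := (nseq k tt).

Lemma tval_mktuple_comp n A B (f : A -> B) (w : n.-tuple A) :
  val [tuple f (tnth w i) | i < n] = map f w.
Proof. by rewrite /= -[in RHS](map_tnth_enum w) -map_comp enumT. Qed.

(** * Transfer between the algebra and the numbers *)

Section Presentation.
Variables (S : algebra) (phi : seq unit -> S).
Variable M : fa_automata unit (@rs_arity (alg_structure S)).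
Hypothesis M_rel : forall i, recognizes (fa_rel M i)
  (conv_lang (Lambda [set: seq unit] phi (@rs_rel (alg_structure S) i))).

Lemma holds_graph i (w : (alg_arity i).+1.-tuple (seq unit)) :
  holds (raw_autom (fa_rel M i)) (map size w) <->
  graph (@alg_op S i) [tuple phi (tnth w j) | j < (alg_arity i).+1].
Proof.
rewrite /holds columns_conv accepts_raw_autom (@M_rel i); split.
  by move=> [w' [_ H] /conv_inj <-].
by move=> H; exists w.
Qed.

Lemma holds_op i (t : (alg_arity i).-tuple S) x y :
  val t = [seq phi (word k) | k <- x] ->
  holds (raw_autom (fa_rel M i)) (rcons x y) <-> phi (word y) = alg_op t.
Proof.
move=> tx; have sx : size x == alg_arity i by rewrite -(size_tuple t) tx size_map.
pose w : (alg_arity i).+1.-tuple (seq unit) :=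
  [tuple of rcons (map_tuple (fun k => word k) (Tuple sx)) (word y)].
have -> : rcons x y = map size w.
  rewrite /= map_rcons -map_comp size_nseq; congr rcons.
  by rewrite -[LHS]map_id; apply: eq_map => k /=; rewrite size_nseq.
rewrite holds_graph.
have vw : val [tuple phi (tnth w j) | j < (alg_arity i).+1] = rcons t (phi (word y)).
  by rewrite tval_mktuple_comp /= map_rcons -map_comp tx.
split=> [[t' _ /(congr1 val)]|e].
  by rewrite vw /= => /rcons_inj[/val_inj -> ->].
by exists t => //; apply: val_inj; rewrite vw /= e.
Qed.

End Presentation.

(** The bijection from k to the image of a^k carries the subalgebra to [T'] and the operations to
    the relations on numbers, so [check_complete] and [check_sound] apply. *)
Lemma algorithm_correct (S : algebra) (phi : seq unit -> S)
    (M : fa_automata unit (@rs_arity (alg_structure S))) (ws : seq (seq unit)) (T : set S) :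
  set_surj [set: seq unit] [set: S] phi -> set_inj [set: seq unit] phi ->
  (forall i, recognizes (fa_rel M i)
    (conv_lang (Lambda [set: seq unit] phi (@rs_rel (alg_structure S) i)))) ->
  is_subalgebra T -> T = generated (phi @` [set` ws]) ->
  (exists c, test (raw_input M ws, c)) /\
  forall c, test (raw_input M ws, c) ->
    recognizes (period_nfa (period_of c) (elements_of (raw_input M ws, c))) (phi @^-1` T).
Proof.
move=> phi_surj phi_inj' M_rel subT genT.
have phi_inj : injective phi by move=> w w' /phi_inj'; apply; rewrite inE.
have [psi psiK] : exists psi : S -> nat, forall s, phi (word (psi s)) = s.
  have H s : exists k, phi (word k) = s.
    by have [w _ <-] := phi_surj s I; exists (size w); rewrite -word_size.
  by have [psi Hpsi] := choice H; exists psi.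
have psi_word k : psi (phi (word k)) = k.
  by have /phi_inj/(congr1 size) := psiK (phi (word k)); rewrite !size_nseq.
pose T' u := T (phi (word u)).
set rels := rels_of (raw_input M ws); set gens := map size ws.
have rel_op r : r \in rels -> exists i, r.1 = alg_arity i /\
    r.2.1 = raw_autom (fa_rel M i).
  by move=> /mapP[_ /mapP[i _ ->] ->]; exists i; rewrite /= subn1.
have args_of i (x : seq nat) : size x = alg_arity i ->
    exists t : (alg_arity i).-tuple S, val t = [seq phi (word k) | k <- x].
  by move=> /eqP sx; exists (map_tuple (fun k => phi (word k)) (Tuple sx)).
have T_gens (g : nat) : g \in gens -> T' g.
  move=> /mapP[w wws ->]; rewrite /T' -word_size genT => A [_]; apply.
  by exists w.
have T_op r (x : seq nat) (y : nat) : r \in rels -> size x = r.1 ->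
    (forall u : nat, u \in x -> T' u) -> holds r.2.1 (rcons x y) -> T' y.
  move=> /rel_op[i [-> ->]] /args_of[t tx] Tx /(holds_op M_rel _ tx) e.
  rewrite /T' e; apply: subT => j.
  have jx : j < size x by rewrite -(size_map (fun k => phi (word k))) -tx size_tuple.
  rewrite (tnth_nth (phi [::])) [X in nth _ X _]tx (nth_map 0) //.
  exact/Tx/mem_nth.
have T_ind (P : nat -> Prop) : (forall g : nat, g \in gens -> P g) ->
    (forall r (x : seq nat) (y : nat), r \in rels -> size x = r.1 ->
       (forall u : nat, u \in x -> P u) -> holds r.2.1 (rcons x y) -> P y) ->
    forall u, T' u -> P u.
  (* Minimality of the generated subalgebra is applied to the set of all [s] with [P (psi s)]. *)
  move=> Pg Pop u; rewrite /T' genT => /(_ [set s | P (psi s)]).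
  rewrite /= psi_word; apply; split=> [i t Pt|_ [w wws <-]] /=; last first.
    by rewrite [w]word_size psi_word; apply: Pg; apply: map_f.
  have ri : (alg_arity i, (raw_autom (fa_rel M i), tt)) \in rels.
    apply/mapP; exists ((alg_arity i).+1, (raw_autom (fa_rel M i), tt)); last by rewrite /= subn1.
    by apply/mapP; exists i; rewrite ?mem_enum.
  apply: (Pop _ (map psi t) _ ri); first by rewrite size_map size_tuple.
    move=> _ /(nthP 0)[j + <-]; rewrite size_map => jt; rewrite (nth_map (phi [::])) //.
    have jn : j < alg_arity i by rewrite -(size_tuple t).
    by have := Pt (Ordinal jn); rewrite (tnth_nth (phi [::])).
  apply/(@holds_op _ _ _ M_rel _ t); last by rewrite psiK.
  by rewrite -map_comp -[LHS]map_id; apply: eq_map => s /=; rewrite psiK.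
have op_total r (x : seq nat) : r \in rels -> size x = r.1 ->
    exists y, holds r.2.1 (rcons x y).
  move=> /rel_op[i [-> ->]] /args_of[t tx]; exists (psi (alg_op t)).
  by apply/(holds_op M_rel _ tx); rewrite psiK.
have op_fun r (x : seq nat) (y y' : nat) : r \in rels -> size x = r.1 ->
    holds r.2.1 (rcons x y) -> holds r.2.1 (rcons x y') -> y = y'.
  move=> /rel_op[i [-> ->]] /args_of[t tx].
  move=> /(holds_op M_rel _ tx) e /(holds_op M_rel _ tx) e'.
  by rewrite -(psi_word y) e -e' psi_word.
split.
  have [e [V0 chk]] := check_complete T_gens T_op T_ind op_total.
  exists (CodeSeq.code (e :: V0)).
  by rewrite /test /elements_of /period_of CodeSeq.codeK.
move=> c /[dup] chk /andP[e0 _] w.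
rewrite period_nfa_accepts //.
have := check_sound T_gens T_op T_ind op_fun chk (size w).
by rewrite /T' -word_size => H; split=> /H.
Qed.

(* The unary alphabet {a} is [unit], and a^* is [set: seq unit]. *)
Theorem theorem5p1 :
  exists p : recfun 1,
  forall (S : algebra) (phi : seq unit -> S),
    @injective_fa_presentation unit (alg_structure S) [set: seq unit] phi ->
  forall T : set S,
    fg_subalgebra T ->
    regular (phi @^-1` T) /\
    forall (M : fa_automata unit (@rs_arity (alg_structure S)))
           (ws : seq (seq unit)),
      @automata_for unit (alg_structure S) [set: seq unit] phi M ->
      T = generated (phi @` [set` ws]) ->
      exists N : nfa unit,
        recognizes N (phi @^-1` T) /\
        rec_eval p [tuple code_input M ws] (code_nfa code_letter N).
Proof.
have [p Hp] := computable_search cpt_test cpt_output; exists p.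
move=> S phi [[regL phi_surj reg_eq reg_rel] phi_inj] T [subT [X finX genX]].
have main (M : fa_automata unit (@rs_arity (alg_structure S))) (ws : seq (seq unit)) :
    @automata_for unit (alg_structure S) [set: seq unit] phi M ->
    T = generated (phi @` [set` ws]) ->
    exists N : nfa unit, recognizes N (phi @^-1` T) /\
      rec_eval p [tuple code_input M ws] (code_nfa code_letter N).
  move=> [_ _ M_rel] genT.
  have [ex_c correct] := algorithm_correct phi_surj phi_inj M_rel subT genT.
  have [c [tc run]] := Hp _ ex_c; eexists; split; first exact: correct tc.
  by rewrite -enc_period_nfa; apply: run; rewrite enc_raw_input.
split=> //.
(* Regularity follows from the effective part, applied to automata chosen for the presentation and
   to preimages of the finite generating set. *)
pose M := FAAutomata (projT1 (cid regL)) (projT1 (cid reg_eq))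
  (fun i => projT1 (cid (reg_rel i))).
have HM : @automata_for unit (alg_structure S) [set: seq unit] phi M.
  split=> [||i]; [exact: (projT2 (cid regL)) | exact: (projT2 (cid reg_eq)) |].
  exact: (projT2 (cid (reg_rel i))).
have [psi psiK] : exists psi : S -> seq unit, forall s, phi (psi s) = s.
  have H s : exists w, phi w = s by have [w _ <-] := phi_surj s I; exists w.
  by have [psi Hpsi] := choice H; exists psi.
have /finite_seqP[ws ews] : finite_set (psi @` X) by exact: finite_image.
have [|N [HN _]] := main M ws HM; last by exists N.
rewrite genX -ews; congr generated.
apply/seteqP; split=> [s Xs|_ [_ [s Xs <-] <-]]; last by rewrite psiK.
by exists (psi s); [exists s | exact: psiK].
Qed.
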